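(* Let $G$ be a $(P_6,C_4,C_6)$-free graph such that $8\leq d(x)\leq 9$ for every $x\in V(G)$ and $G$ does not contain any clique-cutset. Then one of the following holds: (i) $G$ is perfect; (ii) $G$ contains $K$ as an induced subgraph, where $K\in\{K_3\vee P_4,\ K_2\vee C_5,\ K_4\vee(K_2\cup 2K_1),\ K_4\vee 2K_2,\ K_4\vee 4K_1\}$; (iii) $G$ is isomorphic to one of the graphs $G_1$, $G_2$, $G_3$, or $G_4$ (defined in the context).
   Context: All graphs are finite, simple and undirected; $d(x)$ is the degree of $x$. $P_n$, $C_n$, $K_n$ are the chordless path, chordless cycle and complete graph on $n$ vertices. A graph is $(H_1,\dots,H_n)$-free if no induced subgraph of it is isomorphic to any $H_i$. $\chi$ and $\omega$ denote chromatic number and clique number. A graph $G$ is perfect if $\chi(H)=\omega(H)$ for every induced subgraph $H$ of $G$. A clique-cutset of $G$ is a clique $X$ of $G$ such that $G-X$ has more connected components than $G$. For vertex-disjoint graphs, $H\cup H'$ is the disjoint union, $H\vee H'$ (join) is obtained from $H\cup H'$ by adding all edges between $V(H)$ and $V(H')$, and $mH$ is the disjoint union of $m$ copies of $H$. For positive integers $p,q,r$ let $W(p,q,r)$ be the graph whose vertex set is the disjoint union of a clique $Q$ of size $6$, three pairwise non-adjacent vertices $s_1,s_2,s_3$, and three cliques $T_1,T_2,T_3$ of sizes $p,q,r$ respectively, where each $s_i$ is adjacent to all of $Q$ and to all of $T_i$, the cliques $T_1,T_2,T_3$ are pairwise completely joined, and there are no other edges. Then $G_1=W(3,3,2)$,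 $G_2=W(3,3,3)$, $G_3=W(2,3,3)$. The graph $G_4$ is obtained from $C_5$ by replacing every vertex by a clique of size $3$, with two cliques completely joined if the corresponding vertices of $C_5$ are adjacent, and with no edges between them otherwise.
   Formalization: The formal theorem additionally assumes that G is connected; without this the claim fails, since two disjoint copies of G_4 satisfy every hypothesis but none of (i)–(iii). *)

(* Defs.v *)
From mathcomp Require Import all_boot.

Set Implicit Arguments.
Unset Strict Implicit.
Unset Printing Implicit Defensive.

Record sgraph := SGraph {
  vertex :> finType;
  edge : rel vertex;
  edge_sym : symmetric edge;
  edge_irr : irreflexive edge
}.

Definition deg (G : sgraph) (x : G) : nat := #|[set y | edge x y]|.

Definition isomorphic (G H : sgraph) : Prop :=
  exists f : G -> H, bijective f /\ forall x y, edge (f x) (f y) = edge x y.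

Section Induced.
Variables (G : sgraph) (A : {set G}).

Definition induced_edge : rel {x : G | x \in A} :=
  fun u v => edge (val u) (val v).

Lemma induced_edge_sym : symmetric induced_edge.
Proof. by move=> u v; apply: edge_sym. Qed.

Lemma induced_edge_irr : irreflexive induced_edge.
Proof. by move=> u; apply: edge_irr. Qed.

Definition induced : sgraph := SGraph induced_edge_sym induced_edge_irr.
End Induced.

Definition contains_induced (G H : sgraph) : Prop :=
  exists A : {set G}, isomorphic (induced A) H.

Definition free_of (G H : sgraph) : Prop := ~ contains_induced G H.

Definition clique (G : sgraph) (X : {set G}) : bool :=
  [forall x in X, forall y in X, (x != y) ==> edge x y].

Definition omega (G : sgraph) : nat := \max_(X : {set G} | clique X) #|X|.

Definition colorable (G : sgraph) (k : nat) : bool :=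
  [exists c : {ffun G -> 'I_k}, forall x, forall y, edge x y ==> (c x != c y)].

Lemma colorable_card (G : sgraph) : exists k, colorable G k.
Proof.
exists #|G|; apply/existsP; exists [ffun x => enum_rank x].
apply/forallP=> x; apply/forallP=> y; apply/implyP=> xy; rewrite !ffunE.
by apply: contraTneq xy => /enum_rank_inj ->; rewrite edge_irr.
Qed.

Definition chi (G : sgraph) : nat := ex_minn (colorable_card G).

Definition perfect (G : sgraph) : Prop :=
  forall A : {set G}, chi (induced A) = omega (induced A).

Definition connected (G : sgraph) : Prop :=
  forall x y : G, connect (@edge G) x y.

Definition num_components (G : sgraph) : nat := n_comp (@edge G) G.

Definition clique_cutset (G : sgraph) (X : {set G}) : Prop :=
  clique X /\ num_components G < num_components (induced (~: X)).

Section Path.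
Variable n : nat.

Definition path_edge : rel 'I_n := fun i j => (i.+1 == j) || (j.+1 == i).

Lemma path_edge_sym : symmetric path_edge.
Proof. by move=> i j; rewrite /path_edge orbC. Qed.

Lemma path_edge_irr : irreflexive path_edge.
Proof. by move=> i; rewrite /path_edge orbb gtn_eqF. Qed.

Definition path_graph : sgraph := SGraph path_edge_sym path_edge_irr.
End Path.

Section Cycle.
Variable n : nat.

(* The conjunct [i != j] only matters when n = 1. *)
Definition cycle_edge : rel 'I_n := fun i j =>
  (i != j) && ((i.+1 %% n == j) || (j.+1 %% n == i)).

Lemma cycle_edge_sym : symmetric cycle_edge.
Proof. by move=> i j; rewrite /cycle_edge eq_sym orbC. Qed.

Lemma cycle_edge_irr : irreflexive cycle_edge.
Proof. by move=> i; rewrite /cycle_edge eqxx. Qed.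

Definition cycle_graph : sgraph := SGraph cycle_edge_sym cycle_edge_irr.
End Cycle.

Section Complete.
Variable n : nat.

Definition complete_edge : rel 'I_n := fun i j => i != j.

Lemma complete_edge_sym : symmetric complete_edge.
Proof. by move=> i j; rewrite /complete_edge eq_sym. Qed.

Lemma complete_edge_irr : irreflexive complete_edge.
Proof. by move=> i; rewrite /complete_edge eqxx. Qed.

Definition complete_graph : sgraph :=
  SGraph complete_edge_sym complete_edge_irr.
End Complete.

Section UnionJoin.
Variables G H : sgraph.

(* [b] tells whether vertices on different sides are adjacent. *)
Definition sum_edge (b : bool) : rel (G + H) := fun u v =>
  match u, v with
  | inl x, inl y => edge x y
  | inr x, inr y => edge x y
  | _, _ => b
  end.

Lemma sum_edge_sym b : symmetric (sum_edge b).
Proof. by move=> [x|x] [y|y] //=; apply: edge_sym. Qed.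

Lemma sum_edge_irr b : irreflexive (sum_edge b).
Proof. by move=> [x|x] /=; apply: edge_irr. Qed.

Definition disjoint_union : sgraph :=
  SGraph (sum_edge_sym false) (sum_edge_irr false).

Definition join : sgraph := SGraph (sum_edge_sym true) (sum_edge_irr true).
End UnionJoin.

Section Copies.
Variables (m : nat) (H : sgraph).

Definition copies_edge : rel ('I_m * H) := fun u v =>
  (u.1 == v.1) && edge u.2 v.2.

Lemma copies_edge_sym : symmetric copies_edge.
Proof. by move=> u v; rewrite /copies_edge eq_sym edge_sym. Qed.

Lemma copies_edge_irr : irreflexive copies_edge.
Proof. by move=> u; rewrite /copies_edge edge_irr andbF. Qed.

Definition copies : sgraph := SGraph copies_edge_sym copies_edge_irr.
End Copies.

Section Blowup.
Variables (H : sgraph) (k : nat).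

Definition blowup_edge : rel (H * 'I_k) := fun u v =>
  if u.1 == v.1 then u.2 != v.2 else edge u.1 v.1.

Lemma blowup_edge_sym : symmetric blowup_edge.
Proof.
by move=> u v; rewrite /blowup_edge eq_sym (eq_sym u.2) (edge_sym u.1).
Qed.

Lemma blowup_edge_irr : irreflexive blowup_edge.
Proof. by move=> u; rewrite /blowup_edge !eqxx. Qed.

Definition clique_blowup : sgraph := SGraph blowup_edge_sym blowup_edge_irr.
End Blowup.

Section W.
Variables p q r : nat.

(* The summands are Q, {s_1, s_2, s_3}, and the disjoint union of the T_i,
   whose vertices are dependent pairs (i, position in T_i). *)
Definition W_vertex : finType :=
  ('I_6 + ('I_3 + {i : 'I_3 & 'I_(nth 0 [:: p; q; r] i)}))%type.

Definition W_edge : rel W_vertex := fun u v =>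
  match u, v with
  | inl x, inl y => x != y
  | inl _, inr (inl _) | inr (inl _), inl _ => true
  | inl _, inr (inr _) | inr (inr _), inl _ => false
  | inr (inl _), inr (inl _) => false
  | inr (inl i), inr (inr t) | inr (inr t), inr (inl i) => i == tag t
  | inr (inr t), inr (inr t') => t != t'
  end.

Lemma W_edge_sym : symmetric W_edge.
Proof. by move=> [x|[i|t]] [y|[j|t']] //=; rewrite eq_sym. Qed.

Lemma W_edge_irr : irreflexive W_edge.
Proof. by move=> [x|[i|t]] //=; rewrite eqxx. Qed.

Definition W : sgraph := SGraph W_edge_sym W_edge_irr.
End W.

Definition G1 : sgraph := W 3 3 2.
Definition G2 : sgraph := W 3 3 3.
Definition G3 : sgraph := W 2 3 3.
Definition G4 : sgraph := clique_blowup (cycle_graph 5) 3.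

(* Main.v *)
(* Without an induced C5 the graph has no hole, and a graph without holes and
   without clique cutsets is complete.  So fix an induced C5.  Since clique
   cutsets are excluded, the neighbourhood of a connected set Z that misses a
   vertex is not a clique, so two non-adjacent vertices are joined by an induced
   path with one, two or three interior vertices in Z.  It follows that every
   induced C5 is dominating, and that if some vertex has one or two neighbours on
   some induced C5, then one of two graphs on seven vertices is induced in G:
   W(p,q,r) with its cliques shrunk to single vertices, or the graph H obtained
   from C5 by doubling two adjacent vertices and deleting the edge between the
   copies.  If neither is induced, G is a clique blow-up of C5.

   In each of the three cases the vertices outside the base (W, H or C5) are
   sorted by their adjacency to the base.  The few possible types are found by
   exhaustive search for a forbidden induced subgraph, and the degree bounds
   8 <= d(x) <= 9 for the vertices of the base become linear inequalities between
   the sizes of the types, which leave only G1, ..., G4. *)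

Require Import Defs.
From mathcomp Require Import all_boot zify.
From Stdlib Require Import Classical_Prop.

Set Implicit Arguments.
Unset Strict Implicit.
Unset Printing Implicit Defensive.

Ltac vmrefl := vm_compute; reflexivity.

(** * Searching for induced subgraphs *)

(* A graph with vertices 0, ..., n-1 is coded by the strict upper triangle of its
   adjacency matrix: row [i] lists the adjacencies of [i] to [i+1], ..., [n-1], so
   that adding a vertex in front means adding a row in front. *)
Section Tri.
Variable G : sgraph.
Implicit Types (s xs : seq G).

Fixpoint tri xs : seq bitseq :=
  if xs is x :: s then [seq edge x y | y <- s] :: tri s else [::].

Definition has_pat (L : seq bitseq) := exists2 xs : seq G, uniq xs & tri xs = L.

Lemma size_tri xs : size (tri xs) = size xs.
Proof. by elim: xs => //= x s ->. Qed.

End Tri.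

Definition adj (L : seq bitseq) (i j : nat) : bool :=
  if i < j then nth false (nth [::] L i) (j - i.+1)
  else if j < i then nth false (nth [::] L j) (i - j.+1) else false.

Lemma adj_tri (G : sgraph) (x0 : G) xs i j : i < size xs -> j < size xs ->
  adj (tri xs) i j = edge (nth x0 xs i) (nth x0 xs j).
Proof.
have aux k l : k < l -> l < size xs ->
    nth false (nth [::] (tri xs) k) (l - k.+1) = edge (nth x0 xs k) (nth x0 xs l).
  elim: xs k l => [|x s IH] [|k] [|l] //= kl ls.
    by rewrite subn1 (nth_map x0).
  by rewrite subSS IH.
move=> hi hj; rewrite /adj; case: ltngtP => [ij|ji|->].
- exact: aux.
- by rewrite aux // edge_sym.
- by rewrite edge_irr.
Qed.

Definition rows n (e : seq (nat * nat)) : seq bitseq :=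
  [seq [seq ((i, j) \in e) || ((j, i) \in e) | j <- iota i.+1 (n - i.+1)]
     | i <- iota 0 n].

Definition path_pat n := rows n [seq (i, i.+1) | i <- iota 0 n.-1].
Definition cycle_pat n := rows n ((0, n.-1) :: [seq (i, i.+1) | i <- iota 0 n.-1]).
(** The join of [K_m] with [L]; the vertices of the clique are numbered last, so the hub of a wheel
    comes after its rim. *)
Definition cone_pat m (L : seq bitseq) : seq bitseq :=
  [seq r ++ nseq m true | r <- L] ++ [seq nseq i true | i <- rev (iota 0 m)].

(* Call by value does not short-circuit [||] and [&&], hence the conditionals
   in the definitions that are executed. *)
Fixpoint some (T : Type) (a : pred T) (s : seq T) : bool :=
  if s is x :: s' then (if a x then true else some a s') else false.

Lemma someE (T : Type) (a : pred T) s : some a s = has a s.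
Proof. by elim: s => //= x s ->; case: (a x). Qed.

(* [emb L q s]: the indices [s] extend to an induced copy in [L] of the pattern
   whose remaining rows, oldest first, are [q]. *)
Fixpoint emb (L : seq bitseq) (q : seq bitseq) (s : seq nat) : bool :=
  if q is r :: q' then
    some (fun v => if all2 (fun w b => adj L v w == b) s r then
                     if v \in s then false else emb L q' (v :: s)
                   else false) (iota 0 (size L))
  else true.

Definition bad (ps : seq (seq bitseq)) (L : seq bitseq) : bool :=
  some (fun p => emb L (rev p) [::]) ps.

Definition avoids (G : sgraph) (ps : seq (seq bitseq)) :=
  forall p, p \in ps -> ~ has_pat G p.

(** Induction on the remaining rows: [zs] lists the vertices found so far, and an index whose
    adjacencies to [s] spell the next row adds a vertex in front. The equation for [zs] covers all
    defaults because [xs] may be empty. *)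
Lemma emb_sound (G : sgraph) (xs : seq G) q s zs :
  uniq xs -> uniq s -> all (gtn (size xs)) s ->
  (forall x0, zs = [seq nth x0 xs i | i <- s]) -> emb (tri xs) q s ->
  exists2 ys : seq G, uniq ys & tri ys = catrev q (tri zs).
Proof.
move=> uxs; elim: q s zs => [|r q IH] s zs us ss zsE /=.
  move=> _; exists zs => //; case: zs zsE => // z zs zsE; rewrite (zsE z).
  rewrite (map_inj_in_uniq) // => i j /(allP ss) si /(allP ss) sj /eqP.
  by rewrite nth_uniq // => /eqP.
rewrite someE => /hasP[v]; rewrite mem_iota size_tri /= add0n => vxs.
case: ifP => // hr; case: ifPn => // vs hemb.
have {hr} <- : [seq adj (tri xs) v w | w <- s] = r.
  by elim: s r hr {IH us ss zsE vs hemb} => [|w s IHs] [|b r] //= /andP[/eqP-> /IHs->].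
case: xs => // x0 xs in uxs IH ss zsE vxs hemb *.
have [|||ys uys htys] := IH (v :: s) (nth x0 (x0 :: xs) v :: zs) _ _ _ hemb.
- by rewrite /= vs.
- by rewrite /= vxs.
- by move=> x1; rewrite /= -zsE (set_nth_default x1).
exists ys => //; rewrite htys; congr (catrev _ (_ :: _)).
rewrite (zsE x0) -map_comp; apply/eq_in_map => w /(allP ss) ws.
exact: esym (adj_tri x0 vxs ws).
Qed.

Lemma bad_sound (G : sgraph) ps (xs : seq G) :
  avoids G ps -> uniq xs -> ~~ bad ps (tri xs).
Proof.
move=> av uxs; rewrite /bad someE; apply/hasPn => p /av np; apply/negP => he.
have [] := emb_sound (zs := [::]) uxs _ _ _ he => // ys uys htys.
by apply: np; exists ys => //; rewrite htys catrevE revK cats0.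
Qed.

(* [refute ps spec L]: adding new vertices to [L] one by one, with rows taken from
   the successive lists of [spec], always creates a pattern of [ps]. *)
Fixpoint refute (ps : seq (seq bitseq)) (spec : seq (seq bitseq)) (L : seq bitseq) :
    bool :=
  if bad ps L then true else
  if spec is r :: spec' then ~~ some (fun b => ~~ refute ps spec' (b :: L)) r
  else false.

Definition sig (G : sgraph) (cs : seq G) (x : G) : bitseq := [seq edge x c | c <- cs].

Fixpoint agrees (G : sgraph) (spec : seq (seq bitseq)) (cs ys : seq G) :=
  match spec, ys with
  | r :: spec', y :: ys' => (sig cs y \in r) && agrees spec' (y :: cs) ys'
  | [::], [::] => true
  | _, _ => false
  end.

(** A refutation stops at a stage that contains a forbidden pattern. The vertices of that stage form
    a suffix of [catrev ys cs], so these vertices cannot all be distinct. *)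
Lemma refute_sound (G : sgraph) ps spec (cs ys : seq G) :
  avoids G ps -> refute ps spec (tri cs) -> agrees spec cs ys ->
  ~~ uniq (catrev ys cs).
Proof.
move=> av; elim: spec cs ys => [|r spec IH] cs [|y ys] //=.
  by case: ifP => // hb _ _; apply: contraL hb => /(bad_sound av).
case: ifP => [hb _ _|_]; last first.
  rewrite someE => /hasPn hall /andP[hr].
  by apply: (IH (y :: cs)); have := hall _ hr; rewrite negbK.
apply: contraL hb => u; apply: bad_sound av _.
by move: u; rewrite catrevE cat_uniq => /and3P[_ _ /andP[]].
Qed.

Fixpoint bits n : seq bitseq :=
  if n is n'.+1 then [seq true :: b | b <- bits n'] ++ [seq false :: b | b <- bits n']
  else [:: [::]].

Lemma mem_bits b : b \in bits (size b).
Proof.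
elim: b => // b s IH /=; rewrite mem_cat.
by case: b; rewrite map_f ?orbT.
Qed.

Definition types ps (L : seq bitseq) := [seq b <- bits (size L) | ~~ bad ps (b :: L)].

Lemma mem_types (G : sgraph) ps (cs : seq G) x :
  avoids G ps -> uniq (x :: cs) -> sig cs x \in types ps (tri cs).
Proof.
move=> av u; rewrite mem_filter (bad_sound av u) /=.
by have := mem_bits (sig cs x); rewrite size_map size_tri.
Qed.

(** * The named graphs as patterns *)

(** [f] numbers the vertices of [P] by the rows of [L]; composed with a copy of [L] in [G] it is an
    injection, whose image is the required vertex set. *)
Lemma contains_pat (G P : sgraph) L (f : P -> nat) :
  0 < size L -> injective f -> (forall a, f a < size L) ->
  (forall a b, edge a b = adj L (f a) (f b)) ->
  has_pat G L -> contains_induced G P.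
Proof.
move=> L0 finj fL fE [xs uxs xsE].
have szL : size L = size xs by rewrite -xsE size_tri.
have x0 : G by move: L0; rewrite szL; case: (xs).
pose g a := nth x0 xs (f a).
have ginj : injective g.
  by move=> a b /eqP; rewrite nth_uniq -?szL ?fL // => /eqP/finj.
have gE a b : edge (g a) (g b) = edge a b.
  by rewrite fE -xsE (adj_tri x0) // -szL.
pose A := [set g a | a in P].
have gA a : g a \in A by apply: imset_f.
pose h a : induced A := exist _ (g a) (gA a).
have /inj_card_bij hb : injective h by move=> a b /(congr1 val) /ginj.
have /hb [k hK kK] : #|induced A| <= #|P|.
  by rewrite card_sig -[X in _ <= X](card_imset _ ginj) subset_leq_card.
exists A, k; split; first by exists h.
by move=> x y; rewrite -{2}(kK x) -{2}(kK y) -gE.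
Qed.

Lemma path6_pat (G : sgraph) : free_of G (path_graph 6) -> ~ has_pat G (path_pat 6).
Proof.
move=> h hc; apply: h; apply: (contains_pat (P := path_graph 6) (f := @nat_of_ord 6)) hc => //.
- exact: val_inj.
- by do 2!case=> [[|[|[|[|[|[|?]]]]]] ?].
Qed.

Lemma cycle4_pat (G : sgraph) : free_of G (cycle_graph 4) -> ~ has_pat G (cycle_pat 4).
Proof.
move=> h hc; apply: h; apply: (contains_pat (P := cycle_graph 4) (f := @nat_of_ord 4)) hc => //.
- exact: val_inj.
- by do 2!case=> [[|[|[|[|?]]]] ?].
Qed.

Lemma cycle6_pat (G : sgraph) : free_of G (cycle_graph 6) -> ~ has_pat G (cycle_pat 6).
Proof.
move=> h hc; apply: h; apply: (contains_pat (P := cycle_graph 6) (f := @nat_of_ord 6)) hc => //.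
- exact: val_inj.
- by do 2!case=> [[|[|[|[|[|[|?]]]]]] ?].
Qed.

Lemma join_p4_pat (G : sgraph) : has_pat G (cone_pat 3 (path_pat 4)) ->
  contains_induced G (join (complete_graph 3) (path_graph 4)).
Proof.
pose f (a : join (complete_graph 3) (path_graph 4)) : nat :=
  match a with inl i => 4 + i | inr j => j end.
apply: (contains_pat (f := f)) => //.
- by case=> [[i hi]|[i hi]] [[j hj]|[j hj]] /= e; [congr inl|lia|lia|congr inr];
    apply: val_inj => /=; lia.
- by case=> [[i hi]|[i hi]] /=; lia.
- by do 2!case=> [[[|[|[|?]]] ?]|[[|[|[|[|?]]]] ?]].
Qed.

Lemma join_c5_pat (G : sgraph) : has_pat G (cone_pat 2 (cycle_pat 5)) ->
  contains_induced G (join (complete_graph 2) (cycle_graph 5)).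
Proof.
pose f (a : join (complete_graph 2) (cycle_graph 5)) : nat :=
  match a with inl i => 5 + i | inr j => j end.
apply: (contains_pat (f := f)) => //.
- by case=> [[i hi]|[i hi]] [[j hj]|[j hj]] /= e; [congr inl|lia|lia|congr inr];
    apply: val_inj => /=; lia.
- by case=> [[i hi]|[i hi]] /=; lia.
- by do 2!case=> [[[|[|?]] ?]|[[|[|[|[|[|?]]]]] ?]].
Qed.

Lemma join_k2_2k1_pat (G : sgraph) : has_pat G (cone_pat 4 (rows 4 [:: (0, 1)])) ->
  contains_induced G (join (complete_graph 4)
    (disjoint_union (complete_graph 2) (copies 2 (complete_graph 1)))).
Proof.
pose f (a : join (complete_graph 4)
    (disjoint_union (complete_graph 2) (copies 2 (complete_graph 1)))) : nat :=
  match a with inl i => 4 + i | inr (inl j) => j | inr (inr k) => 2 + k.1 end.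
apply: (contains_pat (f := f)) => //.
- case=> [[i hi]|[[i hi]|[[i hi] [[|?] ?]]]] [[j hj]|[[j hj]|[[j hj] [[|?] ?]]]] //= e; try lia.
  + by congr inl; apply: val_inj => /=; lia.
  + by congr (inr (inl _)); apply: val_inj => /=; lia.
  + by congr (inr (inr (_, _))); apply: val_inj => /=; lia.
- by case=> [[i hi]|[[i hi]|[[i hi] ?]]] /=; lia.
- by do 2!case=> [[[|[|[|[|?]]]] ?]|[[[|[|?]] ?]|[[[|[|?]] ?] [[|?] ?]]]].
Qed.

Lemma join_2k2_pat (G : sgraph) : has_pat G (cone_pat 4 (rows 4 [:: (0, 1); (2, 3)])) ->
  contains_induced G (join (complete_graph 4) (copies 2 (complete_graph 2))).
Proof.
pose f (a : join (complete_graph 4) (copies 2 (complete_graph 2))) : nat :=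
  match a with inl i => 4 + i | inr k => 2 * k.1 + k.2 end.
apply: (contains_pat (f := f)) => //.
- case=> [[i hi]|[[i hi] [i' hi']]] [[j hj]|[[j hj] [j' hj']]] //= e; try lia.
  + by congr inl; apply: val_inj => /=; lia.
  + by congr (inr (_, _)); apply: val_inj => /=; lia.
- by case=> [[i hi]|[[i hi] [i' hi']]] /=; lia.
- by do 2!case=> [[[|[|[|[|?]]]] ?]|[[[|[|?]] ?] [[|[|?]] ?]]].
Qed.

Lemma join_4k1_pat (G : sgraph) : has_pat G (cone_pat 4 (rows 4 [::])) ->
  contains_induced G (join (complete_graph 4) (copies 4 (complete_graph 1))).
Proof.
pose f (a : join (complete_graph 4) (copies 4 (complete_graph 1))) : nat :=
  match a with inl i => 4 + i | inr k => k.1 end.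
apply: (contains_pat (f := f)) => //.
- case=> [[i hi]|[[i hi] [[|?] ?]]] [[j hj]|[[j hj] [[|?] ?]]] //= e; try lia.
  + by congr inl; apply: val_inj => /=; lia.
  + by congr (inr (_, _)); apply: val_inj => /=; lia.
- by case=> [[i hi]|[[i hi] ?]] /=; lia.
- by do 2!case=> [[[|[|[|[|?]]]] ?]|[[[|[|[|[|?]]]] ?] [[|?] ?]]].
Qed.

(** * Consequences of the absence of clique cutsets *)

Lemma num_components_le1 (G : sgraph) : connected G -> num_components G <= 1.
Proof.
move=> con; rewrite /num_components /n_comp_mem.
apply/card_le1_eqP => x y; rewrite !inE => /andP[/eqP rx _] /andP[/eqP ry _].
have sc : connect_sym (@edge G) by apply: sym_connect_sym; apply: edge_sym.
by rewrite -rx -ry; apply/eqP; rewrite root_connect.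
Qed.

Lemma num_components_gt1 (G : sgraph) (x y : G) :
  ~~ connect (@edge G) x y -> 1 < num_components G.
Proof.
have sc : connect_sym (@edge G) by apply: sym_connect_sym; apply: edge_sym.
move=> nxy; rewrite /num_components /n_comp_mem; apply/card_gt1P.
exists (root (@edge G) x), (root (@edge G) y).
by rewrite !inE !(roots_root sc) root_connect.
Qed.

Lemma path_patsE : [seq path_pat k | k <- [:: 3; 4; 5]] =
  [:: [:: [:: true; false]; [:: true]; [::]];
      [:: [:: true; false; false]; [:: true; false]; [:: true]; [::]];
      [:: [:: true; false; false; false]; [:: true; false; false];
          [:: true; false]; [:: true]; [::]]].
Proof. by []. Qed.

Section Attach.
Variable G : sgraph.
Hypothesis con : connected G.
Hypothesis nocut : ~ exists X : {set G}, clique_cutset X.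
Hypothesis P6free : ~ has_pat G (path_pat 6).

(** If the vertices outside [Z] with a neighbour in [Z] formed a clique, deleting them would
    separate [x] from [w]: a path that starts in [Z] and avoids them never leaves [Z]. *)
Lemma nonclique_boundary (Z : {set G}) x w :
  x \in Z -> w \notin Z -> (forall z, z \in Z -> ~~ edge w z) ->
  exists u v z z', [/\ u \notin Z, v \notin Z, u != v, ~~ edge u v &
    [/\ z \in Z, z' \in Z, edge u z & edge v z']].
Proof.
move=> xZ wZ nwZ; pose N := [set u | (u \notin Z) && [exists z in Z, edge u z]].
have [/forallP cl|/forallPn[u]] := boolP (clique N); last first.
  rewrite negb_imply inE => /andP[/andP[uZ /exists_inP[z zZ uz]] /forallPn[v]].
  rewrite !negb_imply inE => /andP[/andP[vZ /exists_inP[z' z'Z vz']]].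
  by case/andP => uv nuv; exists u, v, z, z'.
case: nocut; exists N; split; first exact/forallP.
apply: leq_ltn_trans (num_components_le1 con) _.
have xN : x \in ~: N by rewrite !inE xZ.
have wN : w \in ~: N.
  by rewrite !inE wZ /=; apply/exists_inPn => z /nwZ.
pose x' : induced (~: N) := exist _ x xN.
pose w' : induced (~: N) := exist _ w wN.
apply: (@num_components_gt1 _ x' w').
apply/negP=> /connectP[p]; have: val x' \in Z by [].
elim: p x' => [|b p IH] a /= aZ.
  by move=> _ e; move: wZ; rewrite -[w]/(val w') e aZ.
case/andP=> ab pth e; apply: (IH b _ pth e).
have := valP b; rewrite !inE; case: (boolP (val b \in Z)) => //= _ /exists_inPn.
by move/(_ _ aZ); rewrite edge_sym [edge _ _]ab.
Qed.

Let edge_neq (x y : G) : edge x y -> x != y.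
Proof. by apply: contraTneq => ->; rewrite edge_irr. Qed.

(* On a shortest walk; four interior vertices would give an induced P6. *)
Lemma attach_walk (X : {set G}) u v z p :
  u \notin X -> v \notin X -> u != v -> ~~ edge u v -> path (@edge G) z p ->
  {subset z :: p <= X} -> edge v z -> edge u (last z p) ->
  exists s : seq G, [/\ {subset s <= X}, uniq s, 0 < size s <= 3 &
    tri (v :: rcons s u) \in [seq path_pat k | k <- [:: 3; 4; 5]]].
Proof.
move=> uX vX uv nuv; rewrite path_patsE.
elim: {p}(size p).+1 {-2}p z (ltnSn (size p)) => // n IH p z szp pth sX vz uz.
set goal := exists s, _.
(* A shorter walk on the same vertices is settled by induction, so from here on every adjacency that
   shortens the walk may be assumed absent. *)
have short q y : size q < size p -> path (@edge G) y q -> all (mem (z :: p)) (y :: q) ->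
    edge v y -> edge u (last y q) -> goal.
  by move=> szq pq /allP sq; apply: IH => //; [lia | move=> a /sq /sX].
have nvu : edge v u = false by rewrite edge_sym (negbTE nuv).
have vnX y : y \in z :: p -> v != y by move/sX => yX; apply: contraNneq vX => ->.
case: p => [|z1 [|z2 [|z3 r]]] /= in szp pth sX uz short vnX *.
- exists [:: z]; rewrite /= !inE vz nvu edge_sym uz; by split.
- case/andP: pth => e1 _.
  have [h|nvz1] := boolP (edge v z1).
    by apply: (short [::] z1); rewrite //= !inE eqxx orbT.
  have [h|nuz0] := boolP (edge u z).
    by apply: (short [::] z); rewrite //= !inE eqxx.
  exists [:: z; z1]; rewrite /= !inE vz nvu (negbTE nvz1) e1 (edge_sym z) (negbTE nuz0).
  by rewrite (edge_sym z1) uz edge_neq.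
- case/and3P: pth => e1 e2 _.
  have [h|nvz1] := boolP (edge v z1).
    by apply: (short [:: z2] z1); rewrite /= ?e2 ?inE ?eqxx ?orbT.
  have [h|nvz2] := boolP (edge v z2).
    by apply: (short [::] z2); rewrite /= ?inE ?eqxx ?orbT.
  have [h|nuz0] := boolP (edge u z).
    by apply: (short [::] z); rewrite /= ?inE ?eqxx ?orbT.
  have [h|nuz1] := boolP (edge u z1).
    by apply: (short [:: z1] z); rewrite /= ?e1 ?inE ?eqxx ?orbT.
  have [h|nz2] := boolP (edge z z2).
    by apply: (short [:: z2] z); rewrite /= ?h ?inE ?eqxx ?orbT.
  have zz2 : z != z2 by apply: contraNneq nvz2 => <-.
  exists [:: z; z1; z2]; rewrite /= !inE vz nvu (negbTE nvz1) (negbTE nvz2) e1 e2 (negbTE nz2).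
  rewrite (edge_sym z u) (negbTE nuz0) (edge_sym z1 u) (negbTE nuz1) (edge_sym z2 u) uz.
  by rewrite (negbTE zz2) (negbTE (edge_neq e1)) edge_neq.
case/and4P: pth => e1 e2 e3 pr.
have sr : all (mem [:: z, z1, z2, z3 & r]) r.
  by apply/allP => a ar; rewrite !inE ar !orbT.
have sz1 : size r < (size r).+3 by exact: (leq_addl 2 (size r).+1).
have sz2 : (size r).+1 < (size r).+3 by exact: (leq_addl 1 (size r).+2).
have [h|nvz1] := boolP (edge v z1).
  by apply: (short [:: z2, z3 & r] z1); rewrite /= ?e2 ?e3 ?inE ?eqxx ?orbT.
have [h|nvz2] := boolP (edge v z2).
  by apply: (short (z3 :: r) z2); rewrite /= ?e3 ?inE ?eqxx ?orbT ?sz2.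
have [h|nvz3] := boolP (edge v z3).
  by apply: (short r z3); rewrite /= ?inE ?eqxx ?orbT ?sz1.
have [h|nz2] := boolP (edge z z2).
  by apply: (short [:: z2, z3 & r] z); rewrite /= ?h ?e3 ?inE ?eqxx ?orbT.
have [h|nz3] := boolP (edge z z3).
  by apply: (short (z3 :: r) z); rewrite /= ?h ?inE ?eqxx ?orbT ?sz2.
have [h|nz13] := boolP (edge z1 z3).
  by apply: (short [:: z1, z3 & r] z); rewrite /= ?h ?e1 ?inE ?eqxx ?orbT.
have zz2 : z != z2 by apply: contraNneq nvz2 => <-.
have zz3 : z != z3 by apply: contraNneq nvz3 => <-.
have zz13 : z1 != z3 by apply: contraNneq nz3 => <-.
(* The sixth vertex [y] of the induced path is the next vertex of the walk, or [u] if the walk ends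
   at [z3]. *)
suff [//|[y [ny1 ny2 ey /and3P[nz0y nz1y nz2y]]]] : goal \/ exists y,
    [/\ v != y, ~~ edge v y, edge z3 y &
        [&& ~~ edge z y, ~~ edge z1 y & ~~ edge z2 y]].
  case: P6free; exists [:: v; z; z1; z2; z3; y]; last first.
    by rewrite /= vz e1 e2 e3 ey (negbTE nvz1) (negbTE nvz2) (negbTE nvz3) (negbTE ny2)
               (negbTE nz2) (negbTE nz3) (negbTE nz13) (negbTE nz0y) (negbTE nz1y) (negbTE nz2y).
  rewrite /= !inE !negb_or ny1 zz2 zz3 zz13 !(edge_neq e1, edge_neq e2, edge_neq e3, edge_neq ey).
  rewrite !vnX ?inE ?eqxx ?orbT //=.
  have -> : z != y by apply: contraNneq nz3 => ->; rewrite edge_sym.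
  have -> : z1 != y by apply: contraNneq nz13 => ->; rewrite edge_sym.
  by have -> : z2 != y by apply: contraNneq nz1y => <-.
case: r => [|z4 r] /= in szp sX uz short vnX pr sr sz1 sz2 *.
  have [h|nz0y] := boolP (edge u z).
    by left; apply: (short [::] z); rewrite /= ?inE ?eqxx ?orbT.
  have [h|nz1y] := boolP (edge u z1).
    by left; apply: (short [:: z1] z); rewrite /= ?e1 ?inE ?eqxx ?orbT.
  have [h|nz2y] := boolP (edge u z2).
    by left; apply: (short [:: z1; z2] z); rewrite /= ?e1 ?e2 ?inE ?eqxx ?orbT.
  right; exists u; rewrite eq_sym uv nvu (edge_sym z3) uz (edge_sym z) (edge_sym z1) (edge_sym z2).
  by rewrite nz0y nz1y nz2y.
have sz3 : size r < (size r).+4 by exact: (leq_addl 3 (size r).+1).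
case/andP: pr => e4 pr; case/andP: sr => _ sr.
have [h|nv4] := boolP (edge v z4).
  by left; apply: (short r z4); rewrite /= ?inE ?eqxx ?orbT ?sz3.
have [h|nz0y] := boolP (edge z z4).
  by left; apply: (short (z4 :: r) z); rewrite /= ?h ?inE ?eqxx ?orbT ?sz1.
have [h|nz1y] := boolP (edge z1 z4).
  by left; apply: (short [:: z1, z4 & r] z); rewrite /= ?h ?e1 ?inE ?eqxx ?orbT ?sz2.
have [h|nz2y] := boolP (edge z2 z4).
  by left; apply: (short [:: z1, z2, z4 & r] z); rewrite /= ?h ?e1 ?e2 ?inE ?eqxx ?orbT.
by right; exists z4; rewrite vnX ?inE ?eqxx ?orbT //; split=> //; apply/and3P.
Qed.

(** Let [Z] be the component of [x] in [X]. Vertices outside [Z] with a neighbour in [Z] lie outside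
    [X]; two of them are non-adjacent by [nonclique_boundary], and a walk in [Z] joins them. *)
Lemma attach (X : {set G}) x w :
  x \in X -> w \notin X -> (forall z, z \in X -> ~~ edge w z) ->
  exists u v s, [/\ u \notin X, v \notin X, {subset s <= X}, uniq (v :: rcons s u) &
    0 < size s <= 3 /\ tri (v :: rcons s u) \in [seq path_pat k | k <- [:: 3; 4; 5]]].
Proof.
move=> xX wX nw; pose e := [rel a b | [&& edge a b, a \in X & b \in X]].
have sc : connect_sym e.
  by apply: sym_connect_sym => a b; rewrite /= edge_sym [(b \in X) && _]andbC.
pose Z := [set z | connect e x z].
have ZX z : z \in Z -> z \in X.
  rewrite inE => /connectP[p]; elim/last_ind: p => [_ ->//|p a _].
  by rewrite rcons_path last_rcons => /andP[_ /and3P[_ _ aX]] ->.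
have [||z /ZX /nw //|u [v [z [z' [uZ vZ uv nuv [zZ z'Z uz vz']]]]]] :=
    @nonclique_boundary Z x w.
- by rewrite inE connect0.
- exact: contra (@ZX w) wX.
have ZN a b : a \in Z -> b \notin Z -> edge b a -> b \notin X.
  move=> aZ bZ ba; apply: contra bZ => bX; rewrite inE.
  have := aZ; rewrite inE => /connect_trans; apply; apply: connect1.
  by rewrite /= edge_sym ba bX ZX.
have : connect e z z'.
  by apply: (@connect_trans _ _ x); [rewrite sc; rewrite inE in zZ|rewrite inE in z'Z].
case/connectP=> p pth pE.
have [||||||||s [sX us ss ts]] := @attach_walk X v u z p.
- exact: ZN z'Z vZ vz'.
- exact: ZN zZ uZ uz.
- by rewrite eq_sym.
- by rewrite edge_sym.
- by apply: sub_path pth => a b /andP[].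
- move=> a; rewrite inE => /predU1P[->|]; first exact: ZX.
  elim: p z pth {pE zZ uz} => //= b p IH z /andP[/and3P[_ _ bX] pth].
  by rewrite inE => /predU1P[->|/(IH _ pth)].
- exact: uz.
- by rewrite -pE.
exists v, u, s; split=> //.
- exact: ZN z'Z vZ vz'.
- exact: ZN zZ uZ uz.
have nX a : a \notin X -> a \notin s by apply: contra => /sX.
rewrite /= mem_rcons inE negb_or uv nX ?(ZN _ _ zZ uZ uz) //= rcons_uniq us.
by rewrite nX // (ZN _ _ z'Z vZ vz').
Qed.
End Attach.

(* Rows of the vertices of a path u - z_k - ... - z_1 - v added to a graph, where the
   z_i have row [m] and [u], [v] have rows in [T]. *)
Definition chain_spec (T : seq bitseq) (m : bitseq) k : seq (seq bitseq) :=
  T :: [seq [:: true :: nseq t false ++ m] | t <- iota 0 k] ++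
  [:: [seq true :: nseq k false ++ b | b <- T]].

Definition nbrs_clique (L : seq bitseq) (m : bitseq) :=
  all (fun i => all (fun j => [&& nth false m i, nth false m j & i != j] ==> adj L i j)
    (iota 0 (size L))) (iota 0 (size L)).

(** The three checks exclude an induced path through the class of [m] with both ends in the base,
    with exactly one end there, and with none. *)
Definition class_refuted ps L T (m : bitseq) : bool :=
  let T' := [seq b <- T | b != m] in
  [&& nbrs_clique L m,
      all (fun i => nth false m i ==>
        all (fun b => nth false b i || bad ps ((true :: b) :: m :: L)) T') (iota 0 (size L)) &
      all (fun k => refute ps (chain_spec T' m k) L) [:: 1; 2; 3]].

Section Classes.
Variables (G : sgraph) (ps : seq (seq bitseq)).
Hypothesis con : connected G.
Hypothesis nocut : ~ exists X : {set G}, clique_cutset X.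
Hypothesis av : avoids G ps.
Hypothesis P6free : ~ has_pat G (path_pat 6).

(** Let [X] be the class of [m]. An entry [false] of [m] gives a base vertex without neighbours in
    [X], so [attach] yields two non-adjacent vertices joined by an induced path through [X]. Each
    check of [class_refuted] excludes one position of these ends. *)
Lemma class_empty (cs : seq G) T m x :
  uniq cs -> (forall y, y \notin cs -> sig cs y \in T) ->
  m \notin [seq sig cs c | c <- cs] -> false \in m -> size m = size cs ->
  class_refuted ps (tri cs) T m -> sig cs x != m.
Proof.
move=> ucs hT mcs /(nthP false)[j jm nj] szm /and3P[hcl h1 hk].
apply/negP => /eqP xm.
have x0 := x; pose X := [set z | sig cs z == m].
have Xcs z : z \in X -> z \notin cs.
  by rewrite inE => /eqP zm; apply: contra mcs => zcs; rewrite -zm map_f.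
have Xadj z i : z \in X -> i < size cs -> edge z (nth x0 cs i) = nth false m i.
  by rewrite inE => /eqP <- ics; rewrite (nth_map x0).
have jcs : j < size cs by rewrite -szm.
have [||z zX|u [v [s [uX vX sX us [szs ts]]]]] := @attach G con nocut P6free X x (nth x0 cs j).
- by rewrite inE xm.
- by apply/negP => /Xcs; rewrite mem_nth.
- by rewrite edge_sym Xadj // nj.
rewrite path_patsE in ts.
have out y : y \notin X -> y \notin cs -> sig cs y \in [seq b <- T | b != m].
  by rewrite inE mem_filter => -> /hT.
have [z1 [zk [z1s zks vz1 zku nuv]]] : exists z1 zk,
    [/\ z1 \in s, zk \in s, edge v z1, edge zk u & edge u v = false].
  case: s szs ts {sX us} => [|a [|b [|c [|]]]] //= _; rewrite !inE => /or3P[] /eqP // -[].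
  - by move=> va vu au; exists a, a; rewrite !inE eqxx (edge_sym u).
  - by move=> va _ vu _ _ bu; exists a, b; rewrite !inE !eqxx orbT (edge_sym u).
  - by move=> va _ _ vu _ _ _ _ _ cu; exists a, c; rewrite !inE !eqxx !orbT (edge_sym u).
have /andP[vus us'] : (v != u) && uniq (rcons s u).
  by move: us; rewrite /= mem_rcons inE negb_or => /andP[/andP[-> _]].
(* A base neighbour of the class is adjacent to every other vertex outside the class that has a
   neighbour in it, so neither end of the path lies in the base. *)
have one i z y : i < size cs -> z \in X -> edge z (nth x0 cs i) -> edge z y -> y \notin X ->
    y != nth x0 cs i -> edge (nth x0 cs i) y.
  move=> ics zX zi zy yX yi; have [ycs|ycs] := boolP (y \in cs).
    move: (ycs) => /(nthP x0)[k kcs yk]; move: yi zy; rewrite -yk => yi zy.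
    move/allP: hcl => /(_ i); rewrite mem_iota size_tri /= ics => /(_ isT).
    move/allP=> /(_ k); rewrite mem_iota /= kcs => /(_ isT).
    rewrite -!(Xadj z) ?zi ?zy ?(adj_tri x0) //= => /implyP; apply.
    by apply: contraNneq yi => ->.
  have := h1; move/allP=> /(_ i); rewrite mem_iota size_tri /= ics => /(_ isT).
  rewrite -(Xadj z) // zi /= => /allP/(_ _ (out _ yX ycs)).
  rewrite (nth_map x0) // edge_sym => /orP[//|hb].
  suff : ~~ bad ps (tri [:: y, z & cs]).
    rewrite /= [edge y z]edge_sym zy; move: zX; rewrite inE => /eqP.
    by rewrite /sig => ->; rewrite hb.
  apply: bad_sound => //=; rewrite inE negb_or ycs (Xcs _ zX) ucs.
  by rewrite !andbT; apply: contraNneq yX => ->.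
have ucs' : u \notin cs.
  apply/negP => /(nthP x0)[i ics iu].
  have z1i : edge z1 (nth x0 cs i) by rewrite Xadj ?sX // -(Xadj zk) ?sX ?iu.
  by have := one i z1 v ics (sX _ z1s) z1i; rewrite iu edge_sym vz1 nuv vus vX => /(_ isT isT isT).
have vcs' : v \notin cs.
  apply/negP => /(nthP x0)[i ics iv].
  have zki : edge zk (nth x0 cs i) by rewrite Xadj ?sX // -(Xadj z1) ?sX // iv edge_sym.
  have := one i zk u ics (sX _ zks) zki zku uX.
  by rewrite iv edge_sym nuv eq_sym vus => /(_ isT).
have sm z : z \in s -> sig cs z = m by move/sX; rewrite inE => /eqP.
have {}us : uniq (catrev (u :: rev s ++ [:: v]) cs).
  have -> : catrev (u :: rev s ++ [:: v]) cs = (v :: rcons s u) ++ cs.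
    by rewrite catrevE rev_cons rev_cat revK.
  rewrite cat_uniq us ucs andbT /=; apply/hasPn => y ycs.
  rewrite /= inE mem_rcons inE !negb_or.
  rewrite (contraNneq _ vcs') ?(contraNneq _ ucs') => [|<-//|<-//].
  by rewrite /=; apply: contraL ycs => /sX /Xcs.
have {}hk : refute ps (chain_spec [seq b <- T | b != m] m (size s)) (tri cs).
  by apply: (allP hk); case: (size s) szs => [|[|[|[|]]]].
apply/negP: us; apply: refute_sound hk _ => //.
have su := out _ uX ucs'; have sv := out _ vX vcs'.
case: s szs ts sm {sX z1s zks us'} => [|a [|b [|c [|]]]] //= _;
  rewrite !inE => /or3P[] /eqP // -[].
- move=> va vu au sm; rewrite su sm ?inE // au va vu /=.
  by rewrite !eqxx map_f.
- move=> va vb vu ab au bu sm.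
  have [sa sb] : sig cs a = m /\ sig cs b = m by rewrite !sm ?inE ?eqxx ?orbT.
  by rewrite su sa sb ab au bu va vb vu /= !eqxx map_f.
- move=> va vb vc vu ab ac au bc bu cu sm.
  have [sa sb sc] : [/\ sig cs a = m, sig cs b = m & sig cs c = m].
    by rewrite !sm ?inE ?eqxx ?orbT.
  by rewrite su sa sb sc ab ac au bc bu cu va vb vc vu /= !eqxx map_f.
Qed.
End Classes.

(** * Counting vertices by their adjacency to a base *)

Definition msk n (s : seq nat) : bitseq := [seq i \in s | i <- iota 0 n].

Definition hole_pats := [:: cycle_pat 4; path_pat 6; cycle_pat 6].
Definition join_pats :=
  [:: cone_pat 3 (path_pat 4); cone_pat 2 (cycle_pat 5);
      cone_pat 4 (rows 4 [:: (0, 1)]); cone_pat 4 (rows 4 [:: (0, 1); (2, 3)]);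
      cone_pat 4 (rows 4 [::])].
Definition c5_k1_pat := nseq 5 false :: cycle_pat 5.
Definition wheel_pat := cone_pat 1 (cycle_pat 5).

Lemma avoids_cons (G : sgraph) p ps : ~ has_pat G p -> avoids G ps -> avoids G (p :: ps).
Proof. by move=> np av q; rewrite inE => /predU1P[->|/av]. Qed.

Lemma avoids_cat (G : sgraph) ps qs : avoids G ps -> avoids G qs -> avoids G (ps ++ qs).
Proof. by move=> av bv q; rewrite mem_cat => /orP[/av|/bv]. Qed.

(** Turns the condition of [class_empty] that no base vertex has row [m] into one decided by
    computation on the pattern. *)
Lemma rows_tri (G : sgraph) (cs : seq G) : [seq sig cs c | c <- cs] =
  [seq [seq adj (tri cs) i j | j <- iota 0 (size (tri cs))] | i <- iota 0 (size (tri cs))].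
Proof.
rewrite size_tri; case: cs => // x0 xs; move: (x0 :: xs) => cs.
rewrite -[X in map _ X = _](mkseq_nth x0 cs) /mkseq -map_comp; apply/eq_in_map => i.
rewrite mem_iota /= => ics; rewrite /sig -[X in map _ X = _](mkseq_nth x0 cs) /mkseq.
rewrite -map_comp; apply/eq_in_map => j; rewrite mem_iota /= => jcs.
by rewrite (adj_tri x0).
Qed.

Section Count.
Variables (G : sgraph) (cs : seq G) (T : seq bitseq).
Hypotheses (ucs : uniq cs) (uT : uniq T).
Hypothesis outT : forall x, x \notin cs -> sig cs x \in T.

Definition cls m := [set x | (x \notin cs) && (sig cs x == m)].

Lemma deg_cls x0 i : i < size cs ->
  deg (nth x0 cs i) = count id (sig cs (nth x0 cs i)) + \sum_(m <- T) nth false m i * #|cls m|.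
Proof.
move=> ics; set c := nth x0 cs i.
have -> : deg c = \sum_x edge c x by rewrite /deg -sum1dep_card big_mkcond.
rewrite (bigID (mem cs)) /=; congr (_ + _).
  rewrite -(big_uniq _ ucs) /=; elim: (cs) => [|d s IH]; first by rewrite big_nil.
  by rewrite big_cons /= IH edge_sym.
have -> : \sum_(m <- T) nth false m i * #|cls m| =
    \sum_(m <- T) \sum_(x | x \notin cs) nth false m i * (sig cs x == m).
  apply: eq_bigr => m _; rewrite -big_distrr /= -sum1dep_card; congr (_ * _).
  by rewrite big_mkcondr; apply: eq_bigr => x _; case: eqP.
rewrite exchange_big /=; apply: eq_bigr => x xcs.
rewrite (bigD1_seq (sig cs x)) ?outT //= eqxx muln1 big1 => [|m mx].
  by rewrite addn0 (nth_map x0) // edge_sym.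
by rewrite eq_sym (negbTE mx) muln0.
Qed.

Lemma cls_eq0 m x : #|cls m| = 0 -> x \notin cs -> sig cs x != m.
Proof.
move=> m0 xcs; apply/negP => xm.
by have := in_set0 x; rewrite -(cards0_eq m0) inE xcs xm.
Qed.
End Count.

(** * Blow-ups *)

(** A vertex goes to the vertex of equal rank in the class of its colour, which is large enough to
    have that rank. *)
Lemma color_injection (U V : finType) (c : U -> nat) (d : V -> nat) :
  (forall i, #|[set x | c x == i]| <= #|[set y | d y == i]|) ->
  exists2 f : U -> V, injective f & forall x, d (f x) = c x.
Proof.
(* An empty [U] is treated apart, since [V] may then offer no default for [nth]. *)
move=> le; have [x0 _|U0] := pickP U; last first.
  have F (x : U) : False by have := U0 x.
  by exists (fun x => False_rect V (F x)) => x; case: (F x).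
have : 0 < #|[set y | d y == c x0]|.
  by apply: leq_trans (le _); apply/card_gt0P; exists x0; rewrite inE.
case/card_gt0P => y0 _.
pose K x := enum [set z | c z == c x]; pose E x := enum [set y | d y == c x].
have sz x : index x (K x) < size (E x).
  apply: leq_trans (_ : size (K x) <= _); last by rewrite /K /E -!cardE.
  by rewrite index_mem mem_enum inE.
pose f x := nth y0 (E x) (index x (K x)).
have df x : d (f x) = c x.
  by have := mem_nth y0 (sz x); rewrite mem_enum inE => /eqP.
exists f => // x y fxy; have cxy : c x = c y by rewrite -df fxy df.
have Exy : E x = E y by rewrite /E cxy.
have Kxy : K x = K y by rewrite /K cxy.
move/eqP: fxy; rewrite /f -Exy -Kxy nth_uniq ?sz ?enum_uniq //; last first.
  by rewrite Exy Kxy sz.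
have [xK yK] : x \in K x /\ y \in K x by rewrite /K !mem_enum !inE cxy.
by move/eqP => e; rewrite -(nth_index x xK) e nth_index.
Qed.

(** Colour-preserving injections exist both ways, so the first one is bijective; adjacency depends
    on the colours only. *)
Lemma iso_coloring (G H : sgraph) (c : G -> nat) (d : H -> nat) (P : rel nat) :
  (forall x y, x != y -> edge x y = P (c x) (c y)) ->
  (forall x y, x != y -> edge x y = P (d x) (d y)) ->
  (forall i, #|[set x | c x == i]| = #|[set y | d y == i]|) ->
  isomorphic G H.
Proof.
move=> cP dP eqc.
have [f finj df] : exists2 f : G -> H, injective f & forall x, d (f x) = c x.
  by apply: color_injection => i; rewrite eqc.
have [g ginj _] : exists2 g : H -> G, injective g & forall x, c (g x) = d x.
  by apply: color_injection => i; rewrite eqc.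
exists f; split; first exact: inj_card_bij finj (leq_card g ginj).
move=> x y; have [->|xy] := eqVneq x y; first by rewrite !edge_irr.
by rewrite dP ?(inj_eq finj) // !df cP.
Qed.

Definition closed_adj (L : seq bitseq) i j := (i == j) || adj L i j.
Definition closed_row (L : seq bitseq) i := [seq closed_adj L i j | j <- iota 0 (size L)].

Section Twins.
Variables (G : sgraph) (L : seq bitseq) (cs : seq G).
Hypotheses (ucs : uniq cs) (tE : tri cs = L).
Let k := size L.
Variable I : seq nat.
Hypothesis Ik : {subset I <= gtn k}.
Hypothesis uL : uniq [seq closed_row L i | i <- iota 0 k].
Hypothesis twin : forall x, x \notin cs ->
  exists2 i, i \in I & sig cs x = closed_row L i.
Hypothesis twins : forall x y i j, x \notin cs -> y \notin cs -> x != y -> i \in I -> j \in I ->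
  sig cs x = closed_row L i -> sig cs y = closed_row L j -> edge x y = closed_adj L i j.

(** With [x] counted as its own neighbour, its adjacencies to the base form a closed row of [L],
    both for a base vertex and for a clone of one; the index of the row names that base vertex. *)
Definition color x := index [seq (x == c) || edge x c | c <- cs]
  [seq closed_row L i | i <- iota 0 k].

Let szcs : size cs = k. Proof. by rewrite -size_tri tE. Qed.

Lemma color_out x i : x \notin cs -> i < k -> sig cs x = closed_row L i -> color x = i.
Proof.
move=> xcs ik sx; rewrite /color; have -> : [seq (x == c) || edge x c | c <- cs] = sig cs x.
  by apply/eq_in_map => c ccs; case: eqP => // xc; rewrite -xc (negbTE xcs) in ccs.
have -> : sig cs x = nth [::] [seq closed_row L i | i <- iota 0 k] i.
  by rewrite (nth_map 0) ?size_iota // nth_iota.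
by rewrite index_uniq // size_map size_iota.
Qed.

Lemma color_in x0 i : i < k -> color (nth x0 cs i) = i.
Proof.
move=> ik; rewrite /color.
have -> : [seq (nth x0 cs i == c) || edge (nth x0 cs i) c | c <- cs] =
    nth [::] [seq closed_row L i | i <- iota 0 k] i.
  rewrite (nth_map 0) ?size_iota // nth_iota // add0n /closed_row -/k.
  rewrite -[X in map _ X = _](mkseq_nth x0 cs) /mkseq -map_comp szcs.
  apply/eq_in_map => j; rewrite mem_iota /= => jk.
  by rewrite nth_uniq ?szcs // /closed_adj -tE (adj_tri x0) ?szcs.
by rewrite index_uniq // size_map size_iota.
Qed.

Lemma twins_edge x y : x != y -> edge x y = closed_adj L (color x) (color y).
Proof.
have sym i j : closed_adj L i j = closed_adj L j i.
  by rewrite /closed_adj eq_sym /adj; case: ltngtP.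
have one z w : z \in cs -> w \notin cs -> edge z w = closed_adj L (color z) (color w).
  move=> /(nthP z)[i ik <-] wcs; have [j /Ik jk sw] := twin wcs.
  rewrite szcs in ik; rewrite color_in // (color_out wcs jk sw) edge_sym sym.
  have -> : edge w (nth z cs i) = nth false (sig cs w) i by rewrite (nth_map z) ?szcs.
  by rewrite sw (nth_map 0) ?size_iota // nth_iota.
move=> xy; have [xcs|xcs] := boolP (x \in cs); have [ycs|ycs] := boolP (y \in cs).
- case/(nthP x): xcs xy => i ik <-; case/(nthP x): ycs => j jk <-; rewrite szcs in ik jk.
  rewrite nth_uniq ?szcs // => ij; rewrite !color_in // /closed_adj (negbTE ij).
  by rewrite -tE (adj_tri x) ?szcs.
- exact: one.
- by rewrite edge_sym sym one.
- have [i iI sx] := twin xcs; have [j jI sy] := twin ycs.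
  rewrite (color_out xcs (Ik iI) sx) (color_out ycs (Ik jI) sy).
  exact: twins xcs ycs xy iI jI sx sy.
Qed.

(** The successor counts the base vertex itself, which [cls] leaves out. *)
Lemma card_color i : i < k ->
  #|[set x | color x == i]| = (#|cls cs (closed_row L i)|).+1.
Proof.
move=> ik; have x0 : G by move: ik; rewrite -szcs; case: (cs).
have -> : [set x | color x == i] = nth x0 cs i |: cls cs (closed_row L i).
  apply/setP => x; rewrite !inE; have [xcs|xcs] := boolP (x \in cs).
    rewrite /= orbF; case/(nthP x0): xcs => j jk <-; rewrite szcs in jk.
    by rewrite color_in // nth_uniq ?szcs.
  have [j /Ik jk sx] := twin xcs; rewrite /= (color_out xcs jk sx) sx.
  have -> : (x == nth x0 cs i) = false.
    by apply: contraNF xcs => /eqP->; rewrite mem_nth ?szcs.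
  apply/eqP/eqP => [->//|e].
  have := uL; move/uniqP => /(_ [::] j i); rewrite !inE size_map size_iota.
  by apply=> //; rewrite !(nth_map 0) ?size_iota // !nth_iota.
by rewrite cardsU1 !inE mem_nth ?szcs.
Qed.

Lemma card_color_ge i : k <= i -> #|[set x | color x == i]| = 0.
Proof.
move=> ki; apply: eq_card0 => x; rewrite !inE; apply: ltn_eqF; apply: leq_trans ki.
have [xcs|xcs] := boolP (x \in cs).
  by case/(nthP x): xcs => j jk <-; rewrite szcs in jk; rewrite color_in.
by have [j /Ik jk sx] := twin xcs; rewrite (color_out xcs jk sx).
Qed.
End Twins.

(* [W 1 1 1] with its clique of size 6 shrunk to the vertex 0; the vertices s_i and
   t_i are numbered i and i + 3. *)
Definition w_pat :=
  rows 7 [:: (0, 1); (0, 2); (0, 3); (1, 4); (2, 5); (3, 6); (4, 5); (5, 6); (4, 6)].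
Definition c5_pats := hole_pats ++ [:: c5_k1_pat; wheel_pat].

Definition w_types : seq (seq nat) :=
  [seq [:: 0; i.+1] | i <- iota 0 3] ++ [seq [:: 0; i.+1; i + 4] | i <- iota 0 3] ++
  [seq [:: i.+1; 4; 5; 6] | i <- iota 0 3] ++ [:: [:: 0]; [:: 4; 5; 6]; [:: 0; 1; 2; 3]].
(** The rows that three clones of vertex 0 will rule out; with [w_twins] and [[:: 4; 5; 6]] they
    exhaust [w_types]. *)
Definition w_small := [:: [:: 0]; [:: 0; 1]; [:: 0; 2]; [:: 0; 3];
                     [:: 0; 1; 4]; [:: 0; 2; 5]; [:: 0; 3; 6]].
(** The closed rows of the vertices 0, 4, 5 and 6. *)
Definition w_twins := [:: [:: 0; 1; 2; 3]; [:: 1; 4; 5; 6]; [:: 2; 4; 5; 6]; [:: 3; 4; 5; 6]].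

Lemma w_types_uniq : uniq [seq msk (size w_pat) s | s <- w_types].
Proof. by vm_compute. Qed.

Lemma w_types_all : all (mem [seq msk (size w_pat) s | s <- w_types]) (types c5_pats w_pat).
Proof. by vm_compute. Qed.

Lemma isomorphic_trans (G H K : sgraph) : isomorphic G H -> isomorphic H K -> isomorphic G K.
Proof.
case=> f [fb fe] [g [gb ge]]; exists (g \o f); split; first exact: bij_comp.
by move=> x y; rewrite ge fe.
Qed.

Definition w_color p q r (v : W p q r) : nat :=
  match v with inl _ => 0 | inr (inl i) => i.+1 | inr (inr t) => 4 + tag t end.

Lemma w_color_edge p q r (u v : W p q r) : u != v ->
  edge u v = closed_adj w_pat (w_color u) (w_color v).
Proof.
case: u v => [x|[i|t]] [y|[j|u]] //= xy.
- by case: j => [[|[|[|?]]] ?].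
- by case: (tag u) => [[|[|[|?]]] ?].
- by case: i => [[|[|[|?]]] ?].
- have {}xy : i != j by apply: contraNneq xy => ->.
  by case: i j xy => [[|[|[|?]]] ?] [[|[|[|?]]] ?].
- by move: (tag u) => j; case: i j => [[|[|[|?]]] ?] [[|[|[|?]]] ?].
- by case: (tag t) => [[|[|[|?]]] ?].
- by move: (tag t) => i; case: j i => [[|[|[|?]]] ?] [[|[|[|?]]] ?].
- have -> : t != u by apply: contraNneq xy => ->.
  by move: (tag t) (tag u); do 2!case=> [[|[|[|?]]] ?].
Qed.

Lemma w_color_card p q r i :
  #|[set v : W p q r | w_color v == i]| = nth 0 [:: 6; 1; 1; 1; p; q; r] i.
Proof.
rewrite -sum1dep_card !big_sumType /=.
have -> : \sum_(t : {j : 'I_3 & 'I_(nth 0 [:: p; q; r] j)} | 4 + tag t == i) 1 =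
    \sum_(j < 3 | 4 + j == i) nth 0 [:: p; q; r] j.
  (* The trivial second condition gives the predicate the shape that [sig_big_dep] expects. *)
  rewrite (eq_bigl (fun t : {j : 'I_3 & 'I_(nth 0 [:: p; q; r] j)} =>
    (4 + tag t == i) && true)); last by move=> t; rewrite andbT.
  rewrite -(sig_big_dep (fun j : 'I_3 => 4 + j == i) (fun _ _ => true) (fun _ _ => 1)).
  by apply: eq_bigr => j _; rewrite sum1_card card_ord.
rewrite !(big_mkcond (fun _ => _ == _)) /= !big_ord_recl !big_ord0 /=.
case: i => [|[|[|[|[|[|[|i]]]]]]] //=; rewrite ?addn0 ?nth_nil //.
Qed.

(** Exchanging the indices 2 and 3 of the [s_i] and [T_i] permutes the colours by [sw], which
    preserves their adjacency. This covers the one triple of sizes that is not literally that of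
    [G1], [G2] or [G3]. *)
Lemma w_swap : isomorphic (W 3 2 3) (W 3 3 2).
Proof.
pose sw i := if i < 7 then nth 0 [:: 0; 1; 3; 2; 4; 6; 5] i else i.
have swK i : sw (sw i) = i by case: i => [|[|[|[|[|[|[|i]]]]]]].
apply: (iso_coloring (d := sw \o @w_color 3 3 2) (@w_color_edge 3 2 3)) => [x y xy|i].
  rewrite (w_color_edge xy) /=.
  have lt7 (v : W 3 3 2) : w_color v \in iota 0 7.
    by rewrite mem_iota; case: v => [?|[[i ?]|[[i ?] ?]]] //=; lia.
  suff /allP/(_ _ (lt7 x))/allP/(_ _ (lt7 y))/eqP : all (fun i => all (fun j =>
    closed_adj w_pat i j == closed_adj w_pat (sw i) (sw j)) (iota 0 7)) (iota 0 7) by [].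
  by vm_compute.
have -> : [set y | (sw \o @w_color 3 3 2) y == i] = [set y | @w_color 3 3 2 y == sw i].
  by apply/setP => y; rewrite !inE /= -{1}(swK i) (can_eq swK).
by rewrite !w_color_card; case: i => [|[|[|[|[|[|[|i]]]]]]].
Qed.

(* The 5-cycle 0 1 3 5 6 with 1 and 3 doubled into 1, 2 and 3, 4, without the edge 2 4. *)
Definition h_pat := rows 7 [:: (0, 1); (0, 2); (1, 2); (1, 3); (1, 4); (2, 3); (3, 4);
                               (3, 5); (4, 5); (5, 6); (6, 0)].
Definition h_types := [:: [:: 0]; [:: 5]; [:: 0; 1]; [:: 3; 5]; [:: 0; 1; 2]; [:: 3; 4; 5];
  [:: 1; 3]; [:: 0; 1; 2; 3]; [:: 1; 3; 4; 5]; [:: 0; 1; 2; 3; 4]; [:: 1; 2; 3; 4; 5];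
  [:: 0; 1; 6]; [:: 3; 5; 6]; [:: 0; 1; 2; 6]; [:: 3; 4; 5; 6]; [:: 0; 5; 6]].

(** The rows that contain 1 but not 2, or 3 but not 4. *)
Definition h_zeros := [:: [:: 0; 1]; [:: 1; 3]; [:: 1; 3; 4; 5]; [:: 0; 1; 6]; [:: 3; 5];
  [:: 0; 1; 2; 3]; [:: 3; 5; 6]].

Lemma h_types_uniq : uniq [seq msk (size h_pat) s | s <- h_types].
Proof. by vm_compute. Qed.

Lemma h_types_all :
  all (mem [seq msk (size h_pat) s | s <- h_types]) (types (w_pat :: c5_pats) h_pat).
Proof. by vm_compute. Qed.

(** The neighbours of [x] together with [x] and [w] all lie in the closed neighbourhood of [h]. *)
Lemma deg_dominated (G : sgraph) (x h w : G) :
  (forall y, edge x y -> (y == h) || edge h y) -> edge h x -> edge h w -> ~~ edge x w ->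
  x != w -> deg x < deg h.
Proof.
move=> dom hx hw xw nxw.
have sub : x |: (w |: [set y | edge x y]) \subset h |: [set y | edge h y].
  apply/subsetP => y; rewrite !inE => /or3P[/eqP->|/eqP->|/dom //].
    by rewrite hx orbT.
  by rewrite hw orbT.
have := subset_leq_card sub; rewrite !cardsU1 !inE (negbTE nxw) !edge_irr xw /=.
by rewrite -/(deg x) -/(deg h); lia.
Qed.

(** * The base [C_5] and its blow-up [G_4] *)

Definition c5_nbrs := [:: (0, 1, 4); (1, 2, 0); (2, 3, 1); (3, 4, 2); (4, 0, 3)].
Definition c5_twins :=
  [:: [:: 0; 1; 4]; [:: 1; 2; 0]; [:: 2; 3; 1]; [:: 3; 4; 2]; [:: 4; 0; 3]].
Definition hw_pats := c5_pats ++ [:: h_pat; w_pat].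

Lemma c5_twins_uniq : uniq [seq msk 5 s | s <- c5_twins].
Proof. by vm_compute. Qed.

(** [C_4]-freeness puts the middle of two neighbours at distance two among the neighbours, and
    [c5_pats] excludes the empty and the full row. This leaves one, two or three consecutive
    vertices, three being the row of a clone. *)
Lemma c5_types : all (fun b => (b \in [seq msk 5 s | s <- c5_twins]) ||
  has (fun i => rot i b \in [:: msk 5 [:: 0]; msk 5 [:: 0; 1]]) (iota 0 5))
  (types c5_pats (cycle_pat 5)).
Proof. by vm_compute. Qed.

(** This is how [w_pat] and [h_pat] arise: they are among the patterns created by the chains through
    vertices with one or two neighbours on the cycle. *)
Lemma c5_refuted : all (class_refuted hw_pats (cycle_pat 5) (types c5_pats (cycle_pat 5)))
  [:: msk 5 [:: 0]; msk 5 [:: 0; 1]].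
Proof. by vm_compute. Qed.

Lemma c5_rot (G : sgraph) (cs : seq G) i : tri cs = cycle_pat 5 -> tri (rot i cs) = cycle_pat 5.
Proof.
have rot1 (s : seq G) : tri s = cycle_pat 5 -> tri (rot 1 s) = cycle_pat 5.
  case: s => [|a [|b [|c [|d [|e [|]]]]]] //= [ab ac ad ae bc bd be cd ce de].
  by rewrite /= bc bd be cd ce de !(edge_sym _ a) ab ac ad ae.
elim: i => [|i IH] tE; first by rewrite rot0.
have [ic|ic] := ltnP i (size cs); last by rewrite rot_oversize // ltnW.
by rewrite -add1n rotD //; apply/rot1/IH.
Qed.

(** The triangle of distinct vertices of which only the colours are known. *)
Fixpoint color_tri (L : seq bitseq) (c : seq nat) : seq bitseq :=
  if c is i :: c' then [seq closed_adj L i j | j <- c'] :: color_tri L c' else [::].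

Lemma g4_edge (u v : G4) : u != v ->
  edge u v = closed_adj (cycle_pat 5) (nat_of_ord u.1) (nat_of_ord v.1).
Proof.
case: u v => [i a] [j b] /=; rewrite /blowup_edge /=; case: (eqVneq i j) => [<- ab|ij _].
  by rewrite /closed_adj eqxx; apply: contraNneq ab => ->.
by case: i j ij => [[|[|[|[|[|?]]]]] ?] [[|[|[|[|[|?]]]]] ?].
Qed.

Lemma g4_card i : #|[set v : G4 | nat_of_ord v.1 == i]| = if i < 5 then 3 else 0.
Proof.
have -> : [set v : G4 | nat_of_ord v.1 == i] =
    setX [set j : 'I_5 | nat_of_ord j == i] [set: 'I_3].
  by apply/setP => v; rewrite !inE andbT.
rewrite cardsX cardsT card_ord; case: ltnP => i5.
  have -> : [set j : 'I_5 | nat_of_ord j == i] = [set Ordinal i5].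
    by apply/setP => j; rewrite !inE.
  by rewrite cards1.
rewrite eq_card0 // => j; rewrite !inE; apply: ltn_eqF; exact: leq_trans (ltn_ord j) i5.
Qed.

(** * The structure around an induced C5 *)

Section Main.
Variable G : sgraph.
Hypothesis con : connected G.
Hypothesis nocut : ~ exists X : {set G}, clique_cutset X.
Hypothesis hdeg : forall x : G, 8 <= deg x <= 9.
Hypothesis avH : avoids G hole_pats.
Hypothesis avK : avoids G join_pats.

(** A vertex without neighbours on the cycle has the all-false row. For this row only the chain
    check of [class_refuted] has content, and [C_4], [P_6] and [C_6] settle it. *)
Lemma dominating : ~ has_pat G c5_k1_pat.
Proof.
case=> [[|y cs] // /andP[ycs ucs]] [sy tE].
have P6free : ~ has_pat G (path_pat 6) by apply: avH.
suff : sig cs y != nseq 5 false by rewrite [sig _ _]sy.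
apply: (class_empty con nocut avH P6free y ucs (T := types hole_pats (tri cs))).
- by move=> z zcs; apply: mem_types; rewrite //= zcs.
- by rewrite rows_tri tE; vm_compute.
- by [].
- by rewrite -(size_tri cs) tE.
- by rewrite tE; vm_compute.
Qed.

Lemma outside ps L (cs : seq G) S x : avoids G ps -> uniq cs -> tri cs = L ->
  all (mem [seq msk (size L) s | s <- S]) (types ps L) ->
  x \notin cs -> exists2 s, s \in S & sig cs x = msk (size L) s.
Proof.
move=> av ucs tE typS xcs; apply/mapP; apply: (allP typS); rewrite -tE.
by apply: mem_types; rewrite //= xcs.
Qed.

Section Base.
Variables (L : seq bitseq) (cs : seq G).
Hypotheses (ucs : uniq cs) (tE : tri cs = L).
Let k := size L.

Definition num s := #|cls cs (msk k s)|.

Let szcs : size cs = k. Proof. by rewrite -size_tri tE. Qed.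

Section Degrees.
Variable S : seq (seq nat).
Hypothesis uS : uniq [seq msk k s | s <- S].
Hypothesis outS : forall x, x \notin cs -> exists2 s, s \in S & sig cs x = msk k s.

(** [c] and [F] are parameters so that [vmrefl] computes them at each use and leaves an explicit sum
    for [lia]. *)
Lemma deg_eq x0 i c F : i < k -> count id [seq adj L i j | j <- iota 0 k] = c ->
  [seq s <- S | i \in s] = F -> deg (nth x0 cs i) = c + sumn [seq num s | s <- F].
Proof.
move=> ik <- <-; rewrite (deg_cls ucs uS) ?szcs //; last first.
  by move=> x /outS[s sS ->]; apply: map_f.
congr (count _ _ + _).
  rewrite -tE /sig -[X in map _ X](mkseq_nth x0 cs) /mkseq -map_comp szcs.
  by apply/eq_in_map => j; rewrite mem_iota /= => jk; rewrite (adj_tri x0) ?szcs.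
rewrite sumnE !big_map big_filter [RHS]big_mkcond; apply: eq_bigr => s _.
by rewrite (nth_map 0) ?size_iota // nth_iota // add0n; case: (i \in s); rewrite ?mul1n.
Qed.

Lemma deg_bounds i c F : i < k -> count id [seq adj L i j | j <- iota 0 k] = c ->
  [seq s <- S | i \in s] = F -> 8 <= c + sumn [seq num s | s <- F] <= 9.
Proof.
move=> ik cE FE; have x0 : G by move: ik; rewrite -szcs; case: (cs).
by rewrite -(deg_eq x0 ik cE FE).
Qed.

End Degrees.

Variable ps : seq (seq bitseq).
Hypothesis av : avoids G ps.

Lemma pair_ok x y : x \notin cs -> y \notin cs -> x != y ->
  ~~ bad ps ((edge x y :: sig cs x) :: sig cs y :: L).
Proof.
move=> xcs ycs xy; have u : uniq [:: x, y & cs] by rewrite /= inE negb_or xy xcs ycs.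
by have := bad_sound av u; rewrite /= tE.
Qed.

(** Representatives of the two rows would be adjacent or not, and both extensions of the base are
    forbidden. *)
Lemma num_incompat s t : msk k s != msk k t ->
  bad ps ((true :: msk k s) :: msk k t :: L) -> bad ps ((false :: msk k s) :: msk k t :: L) ->
  num s = 0 \/ num t = 0.
Proof.
move=> st b1 b0; have [|/set0Pn[x]] := eqVneq (cls cs (msk k s)) set0.
  by left; rewrite /num; apply/eqP; rewrite cards_eq0; apply/eqP.
have [|/set0Pn[y]] := eqVneq (cls cs (msk k t)) set0.
  by right; rewrite /num; apply/eqP; rewrite cards_eq0; apply/eqP.
rewrite !inE => /andP[ycs /eqP yt] /andP[xcs /eqP xs].
have xy : x != y by apply: contraNneq st => xy; rewrite -xs -yt xy.
by have := pair_ok xcs ycs xy; rewrite xs yt; case: edge; rewrite ?b1 ?b0.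
Qed.

Lemma num_incompat_all (P : seq (seq nat * seq nat)) :
  all (fun p => [&& msk k p.1 != msk k p.2, bad ps ((true :: msk k p.1) :: msk k p.2 :: L) &
                    bad ps ((false :: msk k p.1) :: msk k p.2 :: L)]) P ->
  forall s t, (s, t) \in P -> num s = 0 \/ num t = 0.
Proof. by move=> /allP h s t /h /and3P[]; apply: num_incompat. Qed.

Lemma num_le1 s : bad ps ((true :: msk k s) :: msk k s :: L) ->
  bad ps ((false :: msk k s) :: msk k s :: L) -> num s <= 1.
Proof.
move=> b1 b0; rewrite leqNgt; apply/negP => /card_gt1P[x [y [+ + xy]]].
rewrite !inE => /andP[xcs /eqP xs] /andP[ycs /eqP ys].
by have := pair_ok xcs ycs xy; rewrite xs ys; case: edge; rewrite ?b1 ?b0.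
Qed.

(** Three vertices of row [s] must form a clique, to which a vertex of row [t] is complete; together
    with the base they contain one of the excluded joins. *)
Lemma num_eq0_of_three s t : 3 <= num s ->
  bad ps ((false :: msk k s) :: msk k s :: L) ->
  bad ps ((false :: msk k t) :: msk k s :: L) -> msk k t != msk k s ->
  bad join_pats [:: [:: true, true, true & msk k t], [:: true, true & msk k s],
                    true :: msk k s, msk k s & L] -> num t = 0.
Proof.
case/card_gt2P => y1 [y2 [y3 [[]]]]; rewrite !inE.
move=> /andP[y1cs /eqP y1s] /andP[y2cs /eqP y2s] /andP[y3cs /eqP y3s] [y12 y23 y31].
move=> bs bt ts bj; apply/eqP; rewrite cards_eq0; apply/eqP/setP => x; rewrite !inE.
apply/negP => /andP[xcs /eqP xt].
have adjs y z : y \notin cs -> z \notin cs -> y != z -> sig cs z = msk k s ->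
    sig cs y = msk k s \/ sig cs y = msk k t -> edge y z.
  move=> ycs zcs yz sz [] sy; have := pair_ok ycs zcs yz; rewrite sz sy; case: edge => //.
    by rewrite bs.
  by rewrite bt.
have xs y : sig cs y = msk k s -> x != y.
  by move=> sy; apply: contraNneq ts => xy; rewrite -sy -xt xy.
have x1 := adjs x y1 xcs y1cs (xs _ y1s) y1s (or_intror xt).
have x2 := adjs x y2 xcs y2cs (xs _ y2s) y2s (or_intror xt).
have x3 := adjs x y3 xcs y3cs (xs _ y3s) y3s (or_intror xt).
have e12 := adjs y1 y2 y1cs y2cs y12 y2s (or_introl y1s).
have e23 := adjs y2 y3 y2cs y3cs y23 y3s (or_introl y2s).
have e13 : edge y1 y3.
  by rewrite edge_sym; apply: (adjs y3 y1 y3cs y1cs y31 y1s (or_introl y3s)).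
have : ~~ bad join_pats (tri [:: x, y1, y2, y3 & cs]).
  apply: bad_sound avK _; rewrite /= !inE !negb_or !xs // y12 y23 (eq_sym y1) y31.
  by rewrite xcs y1cs y2cs y3cs ucs.
rewrite /= tE -/(sig cs x) -/(sig cs y1) -/(sig cs y2) -/(sig cs y3).
by rewrite x1 x2 x3 e12 e13 e23 y1s y2s y3s xt bj.
Qed.

End Base.

(** With [K_2] joined to [C_5] excluded, few rows remain. The degree bounds require those that miss
    the hub to cover the rim, which no pairwise compatible rows do. *)
Lemma wheel_free : ~ has_pat G wheel_pat.
Proof.
case=> cs ucs tE.
pose ps := hole_pats ++ [:: c5_k1_pat; cone_pat 2 (cycle_pat 5)].
have av : avoids G ps.
  apply: avoids_cat => //; apply: avoids_cons dominating (avoids_cons _ _) => //.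
  exact: avK.
pose S := [seq [:: i] | i <- iota 0 5] ++ [seq [:: i; (i + 1) %% 5] | i <- iota 0 5] ++
  [seq [:: i; 5] | i <- iota 0 5] ++ [seq [:: i; (i + 1) %% 5; 5] | i <- iota 0 5] ++
  [seq [:: i; (i + 1) %% 5; (i + 2) %% 5; 5] | i <- iota 0 5].
have uS : uniq [seq msk (size wheel_pat) s | s <- S] by vm_compute.
have typS : all (mem [seq msk (size wheel_pat) s | s <- S]) (types ps wheel_pat) by vm_compute.
have db := deg_bounds ucs tE uS (fun x => @outside _ _ _ _ x av ucs tE typS).
pose p i : seq nat := [:: i %% 5; (i + 1) %% 5]; pose q i : seq nat := [:: i %% 5].
pose P := flatten [seq [:: (q i, q (i + 2)); (q i, p (i + 1)); (q i, p (i + 3));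
  (p i, p (i + 1))] | i <- iota 0 5].
have /(num_incompat_all ucs tE av) inc : all (fun p => [&& msk 6 p.1 != msk 6 p.2,
  bad ps ((true :: msk 6 p.1) :: msk 6 p.2 :: wheel_pat) &
  bad ps ((false :: msk 6 p.1) :: msk 6 p.2 :: wheel_pat)]) P by vm_compute.
have {}inc s t : (s, t) \in P -> (num wheel_pat cs s == 0) || (num wheel_pat cs t == 0).
  by move/inc; move: (num _ _) => n; clear => -[->|->]; rewrite ?orbT.
(* The hub has at most four neighbours off the rim, so every rim vertex has a
   neighbour that is not adjacent to the hub. *)
have hub := db 5 _ _ isT ltac:(vmrefl) ltac:(vmrefl).
have c0 : ~~ [&& num wheel_pat cs [:: 0] == 0, num wheel_pat cs [:: 0; 1] == 0 &
    num wheel_pat cs [:: 4; 0] == 0].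
  by have := db 0 _ _ isT ltac:(vmrefl) ltac:(vmrefl); move: hub => /=; clear; lia.
have c1 : ~~ [&& num wheel_pat cs [:: 1] == 0, num wheel_pat cs [:: 1; 2] == 0 &
    num wheel_pat cs [:: 0; 1] == 0].
  by have := db 1 _ _ isT ltac:(vmrefl) ltac:(vmrefl); move: hub => /=; clear; lia.
have c2 : ~~ [&& num wheel_pat cs [:: 2] == 0, num wheel_pat cs [:: 2; 3] == 0 &
    num wheel_pat cs [:: 1; 2] == 0].
  by have := db 2 _ _ isT ltac:(vmrefl) ltac:(vmrefl); move: hub => /=; clear; lia.
have c3 : ~~ [&& num wheel_pat cs [:: 3] == 0, num wheel_pat cs [:: 3; 4] == 0 &
    num wheel_pat cs [:: 2; 3] == 0].
  by have := db 3 _ _ isT ltac:(vmrefl) ltac:(vmrefl); move: hub => /=; clear; lia.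
have c4 : ~~ [&& num wheel_pat cs [:: 4] == 0, num wheel_pat cs [:: 4; 0] == 0 &
    num wheel_pat cs [:: 3; 4] == 0].
  by have := db 4 _ _ isT ltac:(vmrefl) ltac:(vmrefl); move: hub => /=; clear; lia.
move: c0 c1 c2 c3 c4 (inc [:: 0] [:: 2] isT) (inc [:: 1] [:: 3] isT) (inc [:: 2] [:: 4] isT)
  (inc [:: 3] [:: 0] isT) (inc [:: 4] [:: 1] isT) (inc [:: 0] [:: 1; 2] isT)
  (inc [:: 1] [:: 2; 3] isT) (inc [:: 2] [:: 3; 4] isT) (inc [:: 3] [:: 4; 0] isT)
  (inc [:: 4] [:: 0; 1] isT) (inc [:: 0] [:: 3; 4] isT) (inc [:: 1] [:: 4; 0] isT)
  (inc [:: 2] [:: 0; 1] isT) (inc [:: 3] [:: 1; 2] isT) (inc [:: 4] [:: 2; 3] isT)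
  (inc [:: 0; 1] [:: 1; 2] isT) (inc [:: 1; 2] [:: 2; 3] isT) (inc [:: 2; 3] [:: 3; 4] isT)
  (inc [:: 3; 4] [:: 4; 0] isT) (inc [:: 4; 0] [:: 0; 1] isT).
move: (num wheel_pat cs) => n; clear.
(* Only the emptiness of the ten rows that miss the hub matters, so the cases are finite. *)
case: (n [:: 0] == 0) => //=; case: (n [:: 1] == 0) => //=; case: (n [:: 2] == 0) => //=;
  case: (n [:: 3] == 0) => //=; case: (n [:: 4] == 0) => //=; case: (n [:: 0; 1] == 0) => //=;
  case: (n [:: 1; 2] == 0) => //=; case: (n [:: 2; 3] == 0) => //=; case: (n [:: 3; 4] == 0) => //=;
  case: (n [:: 4; 0] == 0) => //=.
Qed.

Lemma avoids_c5_pats : avoids G c5_pats.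
Proof.
apply: avoids_cat => //; apply: avoids_cons; first exact: dominating.
by apply: avoids_cons => //; apply: wheel_free.
Qed.

(** * Graphs containing [w_pat] *)

Section W.
Variable cs : seq G.
Hypotheses (ucs : uniq cs) (tE : tri cs = w_pat).
Local Notation n := (num w_pat cs).

Lemma w_outside x : x \notin cs -> exists2 s, s \in w_types & sig cs x = msk 7 s.
Proof. exact: outside avoids_c5_pats ucs tE w_types_all. Qed.

(** Let [q] be this number. The lower bounds at 1, 2, 3 require at least [18 - 3q] vertices of other
    rows; the upper bound at 0 allows at most [6 - q] of these to see 0. So at least [12 - 2q] have
    a row [[:: i; 4; 5; 6]], while the bound at 4 allows at most 6. *)
Lemma w_Q : 3 <= n [:: 0; 1; 2; 3].
Proof.
have db := deg_bounds ucs tE w_types_uniq w_outside.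
have d0 := db 0 _ _ isT ltac:(vmrefl) ltac:(vmrefl).
have d1 := db 1 _ _ isT ltac:(vmrefl) ltac:(vmrefl).
have d2 := db 2 _ _ isT ltac:(vmrefl) ltac:(vmrefl).
have d3 := db 3 _ _ isT ltac:(vmrefl) ltac:(vmrefl).
have d4 := db 4 _ _ isT ltac:(vmrefl) ltac:(vmrefl).
have d5 := db 5 _ _ isT ltac:(vmrefl) ltac:(vmrefl).
have d6 := db 6 _ _ isT ltac:(vmrefl) ltac:(vmrefl).
pose P := [:: ([:: 0; 1], [:: 0; 2]); ([:: 0; 1], [:: 0; 3]); ([:: 0; 2], [:: 0; 3])].
have /(num_incompat_all ucs tE avoids_c5_pats) inc : all (fun p => [&& msk 7 p.1 != msk 7 p.2,
  bad c5_pats ((true :: msk 7 p.1) :: msk 7 p.2 :: w_pat) &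
  bad c5_pats ((false :: msk 7 p.1) :: msk 7 p.2 :: w_pat)]) P by vm_compute.
move: d0 d1 d2 d3 d4 d5 d6 (inc [:: 0; 1] [:: 0; 2] isT) (inc [:: 0; 1] [:: 0; 3] isT)
  (inc [:: 0; 2] [:: 0; 3] isT).
move: (num w_pat cs) => m /=; clear; lia.
Qed.

(** Vertex 0 and three of its clones form a [K_4] complete to 1, 2, 3 and to a vertex with such a
    row; these four induce [4K_1] or the union of [K_2] and [2K_1]. *)
Lemma w_small_empty s : s \in w_small -> n s = 0.
Proof.
move=> sS.
have /allP/(_ _ sS)/and4P[b1 b2 b3 b4] : all (fun t => let Q := msk 7 [:: 0; 1; 2; 3] in
  [&& bad c5_pats ((false :: Q) :: Q :: w_pat), bad c5_pats ((false :: msk 7 t) :: Q :: w_pat),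
      msk 7 t != Q & bad join_pats [:: [:: true, true, true & msk 7 t], [:: true, true & Q],
                                       true :: Q, Q & w_pat]]) w_small by vm_compute.
exact: (num_eq0_of_three ucs tE avoids_c5_pats w_Q b1 b2 b3 b4).
Qed.

(** Once the rows of [w_small] are gone, only clones remain besides this class, and [class_empty]
    applies with this short list of rows. *)
Lemma w_U x : x \notin cs -> sig cs x != msk 7 [:: 4; 5; 6].
Proof.
move=> xcs; pose T := [seq msk 7 s | s <- [:: 4; 5; 6] :: w_twins].
apply: (class_empty con nocut avoids_c5_pats _ x ucs (T := T)).
- exact: avH.
- move=> y ycs; have [s sS sy] := w_outside ycs.
  have /allP/(_ _ sS)/orP[sT|sT] : all (fun s => (s \in [:: 4; 5; 6] :: w_twins) || (s \in w_small))
      w_types by vm_compute.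
    by rewrite sy map_f.
  by have /cls_eq0/(_ ycs) := w_small_empty sT; rewrite sy eqxx.
- by rewrite rows_tri tE; vm_compute.
- by vm_compute.
- by rewrite -(size_tri cs) tE.
- by rewrite tE; vm_compute.
Qed.

Lemma w_num0 s : s \in [:: 4; 5; 6] :: w_small -> n s = 0.
Proof.
rewrite inE => /predU1P[->|]; last exact: w_small_empty.
apply/eqP; rewrite cards_eq0; apply/eqP/setP => x; rewrite !inE.
by apply/negP => /andP[/w_U/negP].
Qed.

(** Vertex 0 leaves 5 or 6 for its clones. With 6, each clone class of 4, 5, 6 would have at most
    one vertex, but the degree of 4 requires at least five in all; so the number is 5 and each of
    these classes has one or two vertices. *)
Lemma w_sizes : n [:: 0; 1; 2; 3] = 5 /\
  ((n [:: 1; 4; 5; 6], n [:: 2; 4; 5; 6], n [:: 3; 4; 5; 6]) \in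
   [:: (2, 2, 2); (2, 2, 1); (2, 1, 2); (1, 2, 2)]).
Proof.
have db := deg_bounds ucs tE w_types_uniq w_outside.
have d0 := db 0 _ _ isT ltac:(vmrefl) ltac:(vmrefl).
have d1 := db 1 _ _ isT ltac:(vmrefl) ltac:(vmrefl).
have d2 := db 2 _ _ isT ltac:(vmrefl) ltac:(vmrefl).
have d3 := db 3 _ _ isT ltac:(vmrefl) ltac:(vmrefl).
have d4 := db 4 _ _ isT ltac:(vmrefl) ltac:(vmrefl).
have z s := @w_num0 s; move: d0 d1 d2 d3 d4.
rewrite /= (z [:: 0] isT) (z [:: 0; 1] isT) (z [:: 0; 2] isT) (z [:: 0; 3] isT)
  (z [:: 0; 1; 4] isT) (z [:: 0; 2; 5] isT) (z [:: 0; 3; 6] isT) (z [:: 4; 5; 6] isT).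
move: (num w_pat cs) => m; clear=> d0 d1 d2 d3 d4.
have [eq bounds] : m [:: 0; 1; 2; 3] = 5 /\
  [&& 0 < m [:: 1; 4; 5; 6] < 3, 0 < m [:: 2; 4; 5; 6] < 3, 0 < m [:: 3; 4; 5; 6] < 3 &
   5 <= m [:: 1; 4; 5; 6] + m [:: 2; 4; 5; 6] + m [:: 3; 4; 5; 6]] by lia.
split=> //; move: bounds {d0 d1 d2 d3 d4}.
by case: (m [:: 1; _; _; _]) (m [:: 2; _; _; _]) (m [:: 3; _; _; _])
  => [|[|[|?]]] [|[|[|?]]] [|[|[|?]]].
Qed.

Lemma w_iso p q r : n [:: 1; 4; 5; 6] = p -> n [:: 2; 4; 5; 6] = q -> n [:: 3; 4; 5; 6] = r ->
  isomorphic G (W p.+1 q.+1 r.+1).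
Proof.
move=> np nq nr; have [nQ _] := w_sizes.
(* The vertices 1, 2, 3, which represent the [s_i], are not cloned. *)
pose I := [:: 0; 4; 5; 6].
have Ik : {subset I <= gtn (size w_pat)} by apply/allP; vm_compute.
have uL : uniq [seq closed_row w_pat i | i <- iota 0 (size w_pat)] by vm_compute.
have twin x : x \notin cs -> exists2 i, i \in I & sig cs x = closed_row w_pat i.
  move=> xcs; have [s sS sx] := w_outside xcs.
  have /allP/(_ _ sS) : all (fun s => (s \in [:: 4; 5; 6] :: w_small) ||
      has (fun i => msk 7 s == closed_row w_pat i) I) w_types by vm_compute.
  case/orP=> [/w_num0/cls_eq0-/(_ x xcs)|/hasP[i iI /eqP e]]; first by rewrite sx eqxx.
  by exists i => //; rewrite sx.
have twins x y i j : x \notin cs -> y \notin cs -> x != y -> i \in I -> j \in I ->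
    sig cs x = closed_row w_pat i -> sig cs y = closed_row w_pat j ->
    edge x y = closed_adj w_pat i j.
  move=> xcs ycs xy iI jI sx sy; have := pair_ok ucs tE avoids_c5_pats xcs ycs xy.
  rewrite sx sy.
  have /allP/(_ _ iI)/allP/(_ _ jI) : all (fun i => all (fun j => bad c5_pats
    ((~~ closed_adj w_pat i j :: closed_row w_pat i) :: closed_row w_pat j :: w_pat)) I) I.
    by vm_compute.
  by case: (edge x y) (closed_adj w_pat i j) => [] [] // ->.
apply: (iso_coloring (twins_edge ucs tE Ik uL twin twins) (@w_color_edge p.+1 q.+1 r.+1)) => i.
rewrite w_color_card; have [i7|i7] := ltnP i 7; last first.
  rewrite (card_color_ge ucs tE Ik uL twin) //.
  by case: i i7 => [|[|[|[|[|[|[|i]]]]]]] //= _; rewrite nth_nil.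
rewrite (card_color ucs tE Ik uL twin) //.
have E j s : closed_row w_pat j = msk 7 s -> #|cls cs (closed_row w_pat j)| = n s by move=> ->.
case: i i7 => [|[|[|[|[|[|[|i]]]]]]] //= _.
- by rewrite (E 0 [:: 0; 1; 2; 3]) // nQ.
- by rewrite (E 1 [:: 0; 1; 4]) // w_num0.
- by rewrite (E 2 [:: 0; 2; 5]) // w_num0.
- by rewrite (E 3 [:: 0; 3; 6]) // w_num0.
- by rewrite (E 4 [:: 1; 4; 5; 6]) // np.
- by rewrite (E 5 [:: 2; 4; 5; 6]) // nq.
- by rewrite (E 6 [:: 3; 4; 5; 6]) // nr.
Qed.

End W.

Lemma w_case : has_pat G w_pat -> isomorphic G G1 \/ isomorphic G G2 \/ isomorphic G G3.
Proof.
case=> cs ucs tE; have [_] := w_sizes ucs tE.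
rewrite !inE => /or4P[] /eqP[n1 n2 n3]; have := w_iso ucs tE n1 n2 n3.
- by right; left.
- by left.
- by left; apply: isomorphic_trans w_swap.
- by right; right.
Qed.

Hypothesis noW : ~ has_pat G w_pat.

Lemma avoids_h : avoids G (w_pat :: c5_pats).
Proof. by apply: avoids_cons => //; apply: avoids_c5_pats. Qed.

(** * Graphs containing [h_pat] *)

Section H.
Variable cs : seq G.
Hypotheses (ucs : uniq cs) (tE : tri cs = h_pat).
Local Notation n := (num h_pat cs).

Lemma h_outside x : x \notin cs -> exists2 s, s \in h_types & sig cs x = msk 7 s.
Proof. exact: outside avoids_h ucs tE h_types_all. Qed.

(** Every row with 2 contains 1, and 1 has one more neighbour in the base, so the bounds 8 and 9
    leave no room for a row with 1 but not 2. The vertices 4 and 3 behave alike. *)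
Lemma h_zero s : s \in h_zeros -> n s = 0.
Proof.
have db := deg_bounds ucs tE h_types_uniq h_outside.
have d1 := db 1 _ _ isT ltac:(vmrefl) ltac:(vmrefl).
have d2 := db 2 _ _ isT ltac:(vmrefl) ltac:(vmrefl).
have d3 := db 3 _ _ isT ltac:(vmrefl) ltac:(vmrefl).
have d4 := db 4 _ _ isT ltac:(vmrefl) ltac:(vmrefl).
move: d1 d2 d3 d4; rewrite /= !inE.
move: (num h_pat cs) => m; clear=> d1 d2 d3 d4.
do 6!(case/orP; first by move/eqP->; lia).
by move/eqP->; lia.
Qed.

(* A vertex [x] with row [0 1 2] is dominated by vertex 2, whose degree is 8. *)
Lemma h_dominated s a w : (s, a, w) \in [:: ([:: 0; 1; 2], 2, 3); ([:: 3; 4; 5], 4, 1)] ->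
  n s = 0.
Proof.
move=> saw; apply/eqP; rewrite cards_eq0; apply/eqP/setP => x; rewrite !inE.
apply/negP => /andP[xcs /eqP xs].
have szcs : size cs = 7 by rewrite -(size_tri cs) tE.
pose h i := nth x cs i.
have [aS wS] : a < 7 /\ w < 7 by move: saw; rewrite !inE => /orP[] /eqP[_ -> ->].
have xh i : i < 7 -> edge x (h i) = (i \in s).
  move=> i7; have -> : edge x (h i) = nth false (sig cs x) i by rewrite (nth_map x) ?szcs.
  by rewrite xs (nth_map 0) // nth_iota.
have hh i j : i < 7 -> j < 7 -> edge (h i) (h j) = adj h_pat i j.
  by move=> i7 j7; rewrite -tE (adj_tri x) ?szcs.
(* Vertex 1 has larger degree than 2, and 3 than 4, while no degree exceeds 9. *)
have deg8 : deg (h a) <= 8.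
  have de i c F := deg_eq ucs tE h_types_uniq h_outside x (i := i) (c := c) (F := F).
  move: saw (hdeg (h 1)) (hdeg (h 3)); rewrite !inE => /orP[] /eqP[_ -> _].
    rewrite (de 1 _ _ isT ltac:(vmrefl) ltac:(vmrefl)).
    rewrite (de 2 _ _ isT ltac:(vmrefl) ltac:(vmrefl)) /=.
    by move: (num _ _) => m; clear; lia.
  rewrite (de 3 _ _ isT ltac:(vmrefl) ltac:(vmrefl)).
  rewrite (de 4 _ _ isT ltac:(vmrefl) ltac:(vmrefl)) /=.
  by move: (num _ _) => m; clear; lia.
suff : deg x < deg (h a) by move: (hdeg x); lia.
have [sa sw aw] : [/\ a \in s, w \notin s & adj h_pat a w].
  by move: saw; rewrite !inE => /orP[] /eqP[-> -> ->]; vm_compute.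
apply: (@deg_dominated _ _ _ (h w)).
- move=> y xy; have [ycs|ycs] := boolP (y \in cs).
    case/(nthP x): ycs xy => i; rewrite szcs => i7 <-; rewrite -/(h i) xh // => si.
    have /allP/(_ _ saw)/allP/(_ _ si)/= : all (fun p => all (fun i =>
        [&& i < 7, p.1.2 < 7 & (i == p.1.2) || adj h_pat p.1.2 i]) p.1.1)
        [:: ([:: 0; 1; 2], 2, 3); ([:: 3; 4; 5], 4, 1)] by vm_compute.
    by case/and3P => _ _; rewrite hh // => /orP[/eqP->|->]; rewrite ?eqxx ?orbT.
  have [t tS yt] := h_outside ycs.
  have /allP/(_ _ saw)/allP/(_ _ tS)/or3P[at_|tz|bt] : all (fun p => all (fun t =>
      [|| p.1.2 \in t, t \in h_zeros |
          bad (w_pat :: c5_pats) ((true :: msk 7 p.1.1) :: msk 7 t :: h_pat)]) h_types)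
      [:: ([:: 0; 1; 2], 2, 3); ([:: 3; 4; 5], 4, 1)] by vm_compute.
  - have -> : edge (h a) y; last by rewrite orbT.
    have -> : edge (h a) y = nth false (sig cs y) a by rewrite (nth_map x) ?szcs // edge_sym.
    by rewrite yt (nth_map 0) // nth_iota.
  - by have /cls_eq0/(_ ycs) := h_zero tz; rewrite yt eqxx.
  - have xny : x != y by apply: contraTneq xy => ->; rewrite edge_irr.
    by have := pair_ok ucs tE avoids_h xcs ycs xny; rewrite xs yt xy bt.
- by rewrite edge_sym xh.
- by rewrite hh.
- by rewrite xh.
- by apply: contraNneq xcs => ->; rewrite mem_nth // szcs.
Qed.

(** The rows with five entries occur at most once each, so 2 and 4 need at least three vertices of
    rows [[:: 0; 1; 2; 6]] and [[:: 3; 4; 5; 6]]. This empties [[:: 0; 5; 6]], and the degrees of 1,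
    2, 4 and 6 then give exactly three of each and one of each row with five entries. Now 0 and 5
    both need a neighbour of row [[:: 0]] or [[:: 5]], and these rows are incompatible. *)
Lemma h_free : False.
Proof.
have db := deg_bounds ucs tE h_types_uniq h_outside.
have d2 := db 2 _ _ isT ltac:(vmrefl) ltac:(vmrefl).
have d4 := db 4 _ _ isT ltac:(vmrefl) ltac:(vmrefl).
have d6 := db 6 _ _ isT ltac:(vmrefl) ltac:(vmrefl).
have d0 := db 0 _ _ isT ltac:(vmrefl) ltac:(vmrefl).
have d5 := db 5 _ _ isT ltac:(vmrefl) ltac:(vmrefl).
have d1 := db 1 _ _ isT ltac:(vmrefl) ltac:(vmrefl).
have d3 := db 3 _ _ isT ltac:(vmrefl) ltac:(vmrefl).
have av : avoids G (join_pats ++ w_pat :: c5_pats) by apply: avoids_cat avoids_h.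
have a1 : n [:: 0; 1; 2; 3; 4] <= 1 by apply: (num_le1 ucs tE av); vm_compute.
have b1 : n [:: 1; 2; 3; 4; 5] <= 1 by apply: (num_le1 ucs tE av); vm_compute.
have xb : n [:: 0] = 0 \/ n [:: 5] = 0.
  by apply: (num_incompat ucs tE av); vm_compute.
have my : 3 <= n [:: 0; 1; 2; 6] -> n [:: 0; 5; 6] = 0.
  by move=> m3; apply: (num_eq0_of_three ucs tE avoids_h m3); vm_compute.
move: d0 d1 d2 d3 d4 d5 d6 a1 b1 xb my.
have z s := @h_zero s; have e s := @h_dominated s.
rewrite /= (z [:: 0; 1]) // (z [:: 1; 3]) // (z [:: 1; 3; 4; 5]) // (z [:: 0; 1; 6]) //
  (z [:: 3; 5]) // (z [:: 0; 1; 2; 3]) // (z [:: 3; 5; 6]) //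
  (e [:: 0; 1; 2] 2 3) // (e [:: 3; 4; 5] 4 1) //.
move: (num h_pat cs) => m; clear; lia.
Qed.

End H.

Hypothesis noH : ~ has_pat G h_pat.

Lemma avoids_hw : avoids G hw_pats.
Proof.
by apply: avoids_cat; [apply: avoids_c5_pats|do 2!apply: avoids_cons => //].
Qed.

(** * Blow-ups of C5 *)

Section C5.
Variable cs : seq G.
Hypotheses (ucs : uniq cs) (tE : tri cs = cycle_pat 5).

(** Any other row becomes [msk 5 [:: 0]] or [msk 5 [:: 0; 1]] after a rotation of the cycle, and
    [class_empty] excludes these two. *)
Lemma c5_twin x : x \notin cs -> exists2 s, s \in c5_twins & sig cs x = msk 5 s.
Proof.
move=> xcs; have av := avoids_c5_pats.
have typ (ds : seq G) y : uniq ds -> tri ds = cycle_pat 5 -> y \notin ds ->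
    sig ds y \in types c5_pats (cycle_pat 5).
  by move=> uds <- yds; apply: mem_types; rewrite //= yds.
have /(allP c5_types)/orP[/mapP//|/hasP[i _ hi]] := typ cs x ucs tE xcs.
have uds : uniq (rot i cs) by rewrite rot_uniq.
have tds := c5_rot i tE.
have : sig (rot i cs) x != rot i (sig cs x).
  apply: (class_empty con nocut avoids_hw _ x uds (T := types c5_pats (cycle_pat 5))).
  - exact: avH.
  - by move=> y; apply: typ.
  - rewrite rows_tri tds; move: hi; rewrite !inE => /orP[] /eqP->; by vm_compute.
  - by move: hi; rewrite !inE => /orP[] /eqP->.
  - by rewrite size_rot size_map size_rot.
  - by rewrite tds; apply: (allP c5_refuted).
by rewrite /sig map_rot eqxx.
Qed.

Lemma c5_twins_all x y i j : x \notin cs -> y \notin cs -> x != y -> i \in iota 0 5 ->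
  j \in iota 0 5 -> sig cs x = closed_row (cycle_pat 5) i ->
  sig cs y = closed_row (cycle_pat 5) j -> edge x y = closed_adj (cycle_pat 5) i j.
Proof.
move=> xcs ycs xy iI jI sx sy; have := pair_ok ucs tE avoids_hw xcs ycs xy.
rewrite sx sy.
have /allP/(_ _ iI)/allP/(_ _ jI) : all (fun i => all (fun j => bad hw_pats
  ((~~ closed_adj (cycle_pat 5) i j :: closed_row (cycle_pat 5) i) ::
   closed_row (cycle_pat 5) j :: cycle_pat 5)) (iota 0 5)) (iota 0 5) by vm_compute.
by case: (edge x y) (closed_adj (cycle_pat 5) i j) => [] [] // ->.
Qed.

Let I := iota 0 5.
Let Ik : {subset I <= gtn (size (cycle_pat 5))}.
Proof. by move=> i; rewrite mem_iota. Qed.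
Let uL : uniq [seq closed_row (cycle_pat 5) i | i <- iota 0 (size (cycle_pat 5))].
Proof. by vm_compute. Qed.

Let twin x : x \notin cs -> exists2 i, i \in I & sig cs x = closed_row (cycle_pat 5) i.
Proof.
move=> xcs; have [s sS sx] := c5_twin xcs.
have /allP/(_ _ sS)/hasP[i iI /eqP e] : all (fun s => has (fun i =>
  msk 5 s == closed_row (cycle_pat 5) i) I) c5_twins by vm_compute.
by exists i => //; rewrite sx.
Qed.

Local Notation col := (color (cycle_pat 5) cs).

Lemma c5_edge x y : x != y -> edge x y = closed_adj (cycle_pat 5) (col x) (col y).
Proof. by apply: (twins_edge ucs tE Ik uL twin) => u v i j; apply: c5_twins_all. Qed.

Lemma c5_card i : i < 5 ->
  #|[set x | col x == i]| = (num (cycle_pat 5) cs (nth [::] c5_twins i)).+1.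
Proof.
move=> i5; rewrite (card_color ucs tE Ik uL twin i5); congr (#|cls cs _|.+1).
by case: i i5 => [|[|[|[|[|]]]]].
Qed.

(* Four vertices of one class and two of each neighbouring class induce K4 v 2K2. *)
Lemma c5_class_le i j k : (i, j, k) \in c5_nbrs -> 4 <= #|[set x | col x == i]| ->
  2 <= #|[set x | col x == j]| -> 2 <= #|[set x | col x == k]| -> False.
Proof.
move=> ijk h0 h1 h4; pose E m j := take m (enum [set x | col x == j]).
have colE m a x : x \in E m a -> col x = a.
  by move/mem_take; rewrite mem_enum inE => /eqP.
have mapE m a : m <= #|[set x | col x == a]| -> [seq col x | x <- E m a] = nseq m a.
  move=> ma; have szE : size (E m a) = m by rewrite size_takel // -cardE.
  rewrite -[in RHS]szE -(size_map (color (cycle_pat 5) cs)); apply/all_pred1P.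
  rewrite all_map; apply/allP => x /colE /= ->.
  exact: eqxx.
have uE m a : uniq (E m a) by rewrite take_uniq ?enum_uniq.
pose xs := E 4 i ++ E 2 j ++ E 2 k.
have uxs : uniq xs.
  have dis m a m' b : a != b -> ~~ has (mem (E m a)) (E m' b).
    by move=> ab; apply/hasPn => x /colE xb; apply: contraNN ab => /colE <-; rewrite xb.
  have /allP/(_ _ ijk)/and3P[ij ik jk] : all (fun p =>
    [&& p.1.1 != p.1.2, p.1.1 != p.2 & p.1.2 != p.2]) c5_nbrs by [].
  by rewrite !cat_uniq !uE /= has_cat negb_or !dis.
have triE (ys : seq G) : uniq ys -> tri ys = color_tri (cycle_pat 5) [seq col y | y <- ys].
  elim: ys => //= y ys IH /andP[yys uys]; rewrite IH //; congr (_ :: _).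
  rewrite -map_comp; apply/eq_in_map => z zys /=; apply: c5_edge.
  by apply: contraNneq yys => ->.
have av1 : avoids G [:: cone_pat 4 (rows 4 [:: (0, 1); (2, 3)])].
  by move=> p; rewrite inE => /eqP->; apply: avK.
have := bad_sound av1 uxs; rewrite triE // !map_cat !mapE //; apply/negP; rewrite negbK.
have /allP/(_ _ ijk) : all (fun p => bad [:: cone_pat 4 (rows 4 [:: (0, 1); (2, 3)])]
  (color_tri (cycle_pat 5) (nseq 4 p.1.1 ++ nseq 2 p.1.2 ++ nseq 2 p.2))) c5_nbrs by vm_compute.
by [].
Qed.

(** Three consecutive classes have 9 or 10 vertices in all, so sizes of non-adjacent classes differ
    by at most one. A class of size at least 4 would have a neighbouring class of size 1 by
    [c5_class_le], and the class adjacent to neither would be close in size to both. So all sizes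
    are at most 3, hence equal to 3. *)
Lemma c5_iso : isomorphic G G4.
Proof.
have db := deg_bounds ucs tE c5_twins_uniq c5_twin.
have d0 := db 0 _ _ isT ltac:(vmrefl) ltac:(vmrefl).
have d1 := db 1 _ _ isT ltac:(vmrefl) ltac:(vmrefl).
have d2 := db 2 _ _ isT ltac:(vmrefl) ltac:(vmrefl).
have d3 := db 3 _ _ isT ltac:(vmrefl) ltac:(vmrefl).
have d4 := db 4 _ _ isT ltac:(vmrefl) ltac:(vmrefl).
have c i : i < 5 -> num (cycle_pat 5) cs (nth [::] c5_twins i) = 2.
  have := @c5_class_le 0 1 4 isT; have := @c5_class_le 1 2 0 isT.
  have := @c5_class_le 2 3 1 isT; have := @c5_class_le 3 4 2 isT.
  have := @c5_class_le 4 0 3 isT.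
  rewrite (c5_card (i := 0)) // (c5_card (i := 1)) // (c5_card (i := 2)) //.
  rewrite (c5_card (i := 3)) // (c5_card (i := 4)) //.
  by move: d0 d1 d2 d3 d4; case: i => [|[|[|[|[|]]]]] //=; move: (num _ _) => m; clear; lia.
apply: (iso_coloring c5_edge g4_edge) => i; rewrite g4_card.
have [i5|i5] := ltnP i 5; last by rewrite (card_color_ge ucs tE Ik uL twin).
by rewrite c5_card // c.
Qed.

End C5.

End Main.

(** * Graphs without holes *)

(** Both numbers equal the order of [H]. *)
Lemma complete_chi_omega (H : sgraph) : (forall x y : H, x != y -> edge x y) ->
  chi H = omega H.
Proof.
move=> complete; have -> : omega H = #|H|.
  apply/eqP; rewrite eqn_leq; apply/andP; split.
    by apply/bigmax_leqP => X _; apply: max_card.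
  apply: (bigmax_sup [set: H]); last by rewrite cardsT.
  by apply/forall_inP => x _; apply/forall_inP => y _; apply/implyP/complete.
rewrite /chi; case: ex_minnP => k /existsP[c /forallP cP] kmin.
apply/eqP; rewrite eqn_leq; apply/andP; split.
  apply: kmin; apply/existsP; exists [ffun x => enum_rank x].
  apply/forallP=> x; apply/forallP=> y; apply/implyP=> xy; rewrite !ffunE.
  by apply: contraTneq xy => /enum_rank_inj ->; rewrite edge_irr.
rewrite -[k]card_ord; apply: (@leq_card _ _ c) => x y cxy.
apply/eqP; apply: contraT => /complete xy.
by have /forallP/(_ y) := cP x; rewrite xy cxy eqxx.
Qed.

Lemma complete_perfect (G : sgraph) : (forall x y : G, x != y -> edge x y) -> perfect G.
Proof.
move=> complete A; apply: complete_chi_omega => x y xy; apply: complete.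
by rewrite (inj_eq val_inj).
Qed.

(** Apply [attach] to the set of non-neighbours of [x]: the ends of the path it gives are neighbours
    of [x], and [x] closes the path to an induced [C_4], [C_5] or [C_6]. *)
Lemma no_c5_complete (G : sgraph) : connected G -> ~ (exists X : {set G}, clique_cutset X) ->
  avoids G hole_pats -> ~ has_pat G (cycle_pat 5) -> forall x y : G, x != y -> edge x y.
Proof.
move=> con nocut avH noC5 x y xy; apply: contraT => nxy.
pose X := [set z | (z != x) && ~~ edge x z].
have P6free : ~ has_pat G (path_pat 6) by apply: avH.
have [|||u [v [s [uX vX sX us [szs ts]]]]] := @attach G con nocut P6free X y x.
- by rewrite inE eq_sym xy.
- by rewrite inE eqxx.
- by move=> z; rewrite inE => /andP[].
have xs z : z \in s -> (x != z) * (edge x z = false).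
  by move/sX; rewrite inE eq_sym => /andP[-> /negbTE->].
rewrite path_patsE in ts.
have xout w z : w \notin X -> z \in s -> edge w z -> (x != w) * edge x w.
  move=> wX zs wz; have xw : x != w by apply: contraTneq wz => <-; rewrite xs.
  by move: wX; rewrite inE eq_sym xw /= negbK => ->.
have close : (x != v) * edge x v -> (x != u) * edge x u -> uniq (x :: v :: rcons s u).
  move=> xv xu; rewrite /= inE mem_rcons inE !negb_or xv xu.
  move: us => /= ->; rewrite !andbT /=; by apply/negP => /xs; rewrite eqxx => -[].
case: s szs ts xout close {sX us} xs => [|a [|b [|c [|]]]] //= _;
  rewrite !inE => /or3P[] /eqP // -[].
- move=> va vu au xout close xs.
  have xv : (x != v) * edge x v by apply: (xout v a vX); rewrite ?inE.
  have xu : (x != u) * edge x u by apply: (xout u a uX); rewrite ?inE // edge_sym.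
  case: (avH (cycle_pat 4)) => //; exists [:: x; v; a; u]; first by rewrite /= !inE close.
  by rewrite /= xv xu va vu au !xs ?inE ?eqxx.
- move=> va vb vu ab au bu xout close xs.
  have xv : (x != v) * edge x v by apply: (xout v a vX); rewrite ?inE ?eqxx.
  have xu : (x != u) * edge x u by apply: (xout u b uX); rewrite ?inE ?eqxx ?orbT // edge_sym.
  case: noC5; exists [:: x; v; a; b; u]; first by rewrite /= !inE close.
  by rewrite /= xv xu va vb vu ab au bu !xs ?inE ?eqxx ?orbT.
- move=> va vb vc vu ab ac au bc bu cu xout close xs.
  have xv : (x != v) * edge x v by apply: (xout v a vX); rewrite ?inE ?eqxx.
  have xu : (x != u) * edge x u by apply: (xout u c uX); rewrite ?inE ?eqxx ?orbT // edge_sym.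
  case: (avH (cycle_pat 6)) => //; exists [:: x; v; a; b; c; u]; first by rewrite /= !inE close.
  by rewrite /= xv xu va vb vc vu ab ac au bc bu cu !xs ?inE ?eqxx ?orbT.
Qed.

Theorem theorem1p5 (G : sgraph)
    (hP6 : free_of G (path_graph 6))
    (hC4 : free_of G (cycle_graph 4))
    (hC6 : free_of G (cycle_graph 6))
    (hdeg : forall x : G, 8 <= deg x <= 9)
    (hconn : connected G)
    (hcut : ~ exists X : {set G}, clique_cutset X) :
  perfect G
  \/ (contains_induced G (join (complete_graph 3) (path_graph 4))
      \/ contains_induced G (join (complete_graph 2) (cycle_graph 5))
      \/ contains_induced G
           (join (complete_graph 4)
              (disjoint_union (complete_graph 2) (copies 2 (complete_graph 1))))
      \/ contains_induced G
           (join (complete_graph 4) (copies 2 (complete_graph 2)))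
      \/ contains_induced G
           (join (complete_graph 4) (copies 4 (complete_graph 1))))
  \/ (isomorphic G G1 \/ isomorphic G G2 \/ isomorphic G G3 \/ isomorphic G G4).
Proof.
have avH : avoids G hole_pats.
  apply: avoids_cons (cycle4_pat hC4) _; apply: avoids_cons (path6_pat hP6) _.
  by apply: avoids_cons (cycle6_pat hC6) _.
case: (classic (has_pat G (cone_pat 3 (path_pat 4)))) => [/join_p4_pat|n1].
  by right; left; left.
case: (classic (has_pat G (cone_pat 2 (cycle_pat 5)))) => [/join_c5_pat|n2].
  by right; left; right; left.
case: (classic (has_pat G (cone_pat 4 (rows 4 [:: (0, 1)])))) => [/join_k2_2k1_pat|n3].
  by right; left; right; right; left.
case: (classic (has_pat G (cone_pat 4 (rows 4 [:: (0, 1); (2, 3)])))) => [/join_2k2_pat|n4].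
  by right; left; do 3!right; left.
case: (classic (has_pat G (cone_pat 4 (rows 4 [::])))) => [/join_4k1_pat|n5].
  by right; left; do 4!right.
have avK : avoids G join_pats by do 5!apply: avoids_cons => //.
case: (classic (has_pat G (cycle_pat 5))) => [[cs ucs tE]|noC5]; last first.
  by left; apply/complete_perfect/no_c5_complete.
case: (classic (has_pat G w_pat)) => [/(w_case hconn hcut hdeg avH avK)|noW].
  by case=> [|[]] iso; right; right; [left|right; left|do 2!right; left].
have noH : ~ has_pat G h_pat.
  by case=> ds uds dE; apply: (h_free hconn hcut hdeg avH avK noW uds dE).
by do 5!right; apply: (c5_iso hconn hcut hdeg avH avK noW noH ucs tE).
Qed.
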